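(* Let $1/q$ be a prime power and $\Bbbk=\mathbb{F}_{1/q}$. Let $\alpha=(\alpha_1,\dots,\alpha_k)$, $\beta=(\beta_1,\dots,\beta_l)$ be weak compositions of $n$, $M\in\mathbb{N}^{k\times l}$ with row sums $\alpha$ and column sums $\beta$, and $(T,T')$ a pair of semistandard tableaux of the same shape $\lambda\vdash n$ with contents $\alpha$ and $\beta$. Then $$\frac{(1-q)^{-n}}{\prod_{i,j}[M_{i,j}]_q!}\,p_M(T,T')=\frac{q^{n^2-n-n(\alpha)-n(\beta)}(1-q)^{-n}}{[n]_q!}\,|\Omega^{T,T'}_M|=\frac{(1-q)^{-\lambda_1}}{\prod_{i\ge1}[\lambda_i-\lambda_{i+1}]_q!}\mathrm{wt}_q(T)\mathrm{wt}_q(T')\,\tilde p_M(T,T').$$ Consequently, since $\sum_{(T,T')}p_M(T,T')=1$ and $\sum_M\tilde p_M(T,T')=1$, summing gives $$\sum_{M}\frac{(1-q)^{-n}}{\prod_{i,j}[M_{i,j}]_q!}=\sum_{\lambda\vdash n}\sum_{(T,T')}\frac{(1-q)^{-\lambda_1}}{\prod_{i}[\lambda_i-\lambda_{i+1}]_q!}\mathrm{wt}_q(T)\mathrm{wt}_q(T'),$$ the sums being over all $M\in\mathbb{N}^{k\times l}$ with row sums $\alpha$ and column sums $\beta$, and over all pairs of semistandard tableaux of shape $\lambda$ with contents $\alpha,\beta$.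
   Context: $n(\alpha)=\sum\binom{\alpha_i}{2}$; $[m]_q!=\prod_{r\le m}(1+\cdots+q^{r-1})$, $\binom{m}{r}_q=[m]_q!/([r]_q![m-r]_q!)$. $\mathrm{Fl}_\alpha$: chains $0=F_0\subseteq\cdots\subseteq F_k=\Bbbk^n$, $\dim F_i=\alpha_1+\cdots+\alpha_i$. Relative position of $(F,F')\in\mathrm{Fl}_\alpha\times\mathrm{Fl}_\beta$: the $M$ with $\dim(F_i\cap F'_j)=\sum_{i'\le i,j'\le j}M_{i',j'}$. $N$ is strictly compatible with $F$ if $N(F_i)\subseteq F_{i-1}$ for all $i\ge1$; then $N$ is nilpotent and $\mathrm{JF}(N;F)$ is the semistandard tableau whose entries $\le i$ form the shape $\mathrm{JF}(N|_{F_i})$, where for nilpotent $N$, $\mathrm{JF}(N)$ is the partition with $\lambda_1+\cdots+\lambda_i=\dim\ker N^i$. $\Omega_{\alpha,\beta}$ is the set of triples $(F,F',N)$ with $F\in\mathrm{Fl}_\alpha$, $F'\in\mathrm{Fl}_\beta$, $N\in\mathfrak{gl}_n(\Bbbk)$ strictly compatible with both; $\Omega_M$ its subset with $(F,F')$ of relative position $M$; superscript $T,T'$ restricts to $\mathrm{JF}(N;F)=T$, $\mathrm{JF}(N;F')=T'$. Then $p_M(T,T')=|\Omega^{T,T'}_M|/|\Omega_M|$ and $\tilde p_M(T,T')=|\Omega^{T,T'}_M|/|\Omega^{T,T'}_{\alpha,\beta}|$. For a semistandard tableau $T$, $T^{(j)}$ is the shape of the entries $\le j$ and $\mathrm{wt}_q(T)=\prod_{i,j\ge1}\binom{T^{(j)}_i-T^{(j)}_{i+1}}{T^{(j)}_i-T^{(j-1)}_i}_q$.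 *)

(* Defs.v *)
From HB Require Import structures.
From mathcomp Require Import all_boot all_order all_algebra.
Set Implicit Arguments.
Unset Strict Implicit.
Unset Printing Implicit Defensive.
Import Order.TTheory GRing.Theory Num.Theory.
Local Open Scope ring_scope.

(* Conventions:
   - Vectors of F^n are row vectors 'rV[F]_n; a subspace is represented by its
     canonical square matrix <<A>>%MS (so each subspace has a unique representative);
     a matrix N acts by v |-> v *m N.
   - A weak composition with k parts is a : 'I_k -> nat; flags have steps
     F_0, ..., F_k indexed by 'I_k.+1.
   - A semistandard tableau with content a (entries 1..k) is encoded by its chain of
     shapes T^(0) ⊆ ... ⊆ T^(k): T j r = T^(j)_(r+1)  (rows 0-based). *)

Definition psum (k : nat) (a : 'I_k -> nat) (i : nat) : nat :=
  (\sum_(j < k | (j < i)%N) a j)%N.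

Definition nfun (k : nat) (a : 'I_k -> nat) : nat := (\sum_(j < k) 'C(a j, 2))%N.

Section Flags.
Variable F : finFieldType.
Variable n : nat.

Definition flagT (k : nat) := {ffun 'I_k.+1 -> 'M[F]_n}.

Definition is_flag (k : nat) (a : 'I_k -> nat) (f : flagT k) : bool :=
  [forall i : 'I_k.+1, (<<f i>>%MS == f i) && (\rank (f i) == psum a i)] &&
  [forall i : 'I_k, (f (widen_ord (leqnSn k) i) <= f (lift ord0 i))%MS].

Definition strict_compat (k : nat) (f : flagT k) (N : 'M[F]_n) : bool :=
  [forall i : 'I_k, (f (lift ord0 i) *m N <= f (widen_ord (leqnSn k) i))%MS].

Definition relpos (k l : nat) (f : flagT k) (g : flagT l)
    (M : {ffun 'I_k * 'I_l -> 'I_n.+1}) : bool :=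
  [forall i : 'I_k.+1, forall j : 'I_l.+1,
     \rank (f i :&: g j)%MS ==
     (\sum_(a < k | (a < i)%N) \sum_(b < l | (b < j)%N) (M (a, b) : nat))%N].

End Flags.

(* Partitions of n: lam r = lam_(r+1) (at most n nonzero parts). *)
Definition partT (n : nat) := {ffun 'I_n -> 'I_n.+1}.

Definition pent (n : nat) (lam : partT n) (r : nat) : nat :=
  if (insub r : option 'I_n) is Some r' then (lam r' : nat) else 0%N.

Definition nonincr (n : nat) (lam : partT n) : bool :=
  [forall r : 'I_n, (pent lam r.+1 <= pent lam r)%N].

Definition is_partition (n : nat) (lam : partT n) : bool :=
  nonincr lam && ((\sum_(r < n) (lam r : nat))%N == n).

(* Semistandard tableaux as chains of shapes: T j = T^(j). *)
Definition tabT (n k : nat) := {ffun 'I_k.+1 -> partT n}.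

(* T is a semistandard tableau of shape lam and content a:
   T^(0) is empty, each T^(j) is a partition of a_1+...+a_j,
   T^(j)/T^(j-1) is a horizontal strip, and T^(k) = lam. *)
Definition is_ssyt (n k : nat) (a : 'I_k -> nat) (lam : partT n) (T : tabT n k) : bool :=
  [forall r : 'I_n, (T ord0 r : nat) == 0%N] &&
  [forall j : 'I_k.+1, nonincr (T j) && ((\sum_(r < n) (T j r : nat))%N == psum a j)] &&
  [forall j : 'I_k, forall r : 'I_n,
     (pent (T (widen_ord (leqnSn k) j)) r <= pent (T (lift ord0 j)) r)%N &&
     (pent (T (lift ord0 j)) r.+1 <= pent (T (widen_ord (leqnSn k) j)) r)%N] &&
  (T ord_max == lam).

Section JF.
Variable F : finFieldType.
Variable n : nat.

(* JF(N; f) = T : for every j, the partition JF(N|_{F_j}) equals T^(j), i.e.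
   T^(j)_1 + ... + T^(j)_m = dim ker (N|_{F_j})^m = dim (F_j ∩ ker N^m). *)
Definition jf_eq (k : nat) (f : flagT F n k) (N : 'M[F]_n) (T : tabT n k) : bool :=
  [forall j : 'I_k.+1, forall r : 'I_n,
     (T j r : nat) ==
     (\rank (f j :&: kermx (N ^+ r.+1))%MS - \rank (f j :&: kermx (N ^+ r))%MS)%N].

Definition tripleT (k l : nat) := (flagT F n k * flagT F n l * 'M[F]_n)%type.

Definition in_Omega (k l : nat) (a : 'I_k -> nat) (b : 'I_l -> nat) (x : tripleT k l) : bool :=
  is_flag a x.1.1 && is_flag b x.1.2 && strict_compat x.1.1 x.2 && strict_compat x.1.2 x.2.

Definition card_OmegaM (k l : nat) (a : 'I_k -> nat) (b : 'I_l -> nat)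
    (M : {ffun 'I_k * 'I_l -> 'I_n.+1}) : nat :=
  #|[set x : tripleT k l | in_Omega a b x && relpos x.1.1 x.1.2 M]|.

Definition card_OmegaMTT (k l : nat) (a : 'I_k -> nat) (b : 'I_l -> nat)
    (M : {ffun 'I_k * 'I_l -> 'I_n.+1}) (T : tabT n k) (T' : tabT n l) : nat :=
  #|[set x : tripleT k l | in_Omega a b x && relpos x.1.1 x.1.2 M &&
                           jf_eq x.1.1 x.2 T && jf_eq x.1.2 x.2 T']|.

Definition card_OmegaTT (k l : nat) (a : 'I_k -> nat) (b : 'I_l -> nat)
    (T : tabT n k) (T' : tabT n l) : nat :=
  #|[set x : tripleT k l | in_Omega a b x && jf_eq x.1.1 x.2 T && jf_eq x.1.2 x.2 T']|.

Definition pM k l a b M T T' : rat :=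
  (@card_OmegaMTT k l a b M T T')%:R / (@card_OmegaM k l a b M)%:R.

Definition ptM k l a b M T T' : rat :=
  (@card_OmegaMTT k l a b M T T')%:R / (@card_OmegaTT k l a b T T')%:R.

End JF.

Definition qint (q : rat) (m : nat) : rat := \sum_(i < m) q ^+ i.
Definition qfact (q : rat) (m : nat) : rat := \prod_(r < m) qint q r.+1.
Definition qbinom (q : rat) (m r : nat) : rat :=
  qfact q m / (qfact q r * qfact q (m - r)).

Definition wtq (q : rat) (n k : nat) (T : tabT n k) : rat :=
  \prod_(j < k) \prod_(r < n)
    qbinom q (pent (T (lift ord0 j)) r - pent (T (lift ord0 j)) r.+1)
             (pent (T (lift ord0 j)) r - pent (T (widen_ord (leqnSn k) j)) r).

Definition is_contingency (n k l : nat) (a : 'I_k -> nat) (b : 'I_l -> nat)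
    (M : {ffun 'I_k * 'I_l -> 'I_n.+1}) : bool :=
  [forall i : 'I_k, (\sum_(j < l) (M (i, j) : nat))%N == a i] &&
  [forall j : 'I_l, (\sum_(i < k) (M (i, j) : nat))%N == b j].

Definition prodMfact (q : rat) (n k l : nat) (M : {ffun 'I_k * 'I_l -> 'I_n.+1}) : rat :=
  \prod_(i < k) \prod_(j < l) qfact q (M (i, j)).

Definition prodLfact (q : rat) (n : nat) (lam : partT n) : rat :=
  \prod_(r < n) qfact q (pent lam r - pent lam r.+1).

(* Main.v *)
Require Import Defs.
From HB Require Import structures.
From mathcomp Require Import all_boot all_order all_algebra.
From mathcomp Require Import zify ring.
Import Order.TTheory GRing.Theory Num.Theory.
Local Open Scope ring_scope.
Set Implicit Arguments.
Unset Strict Implicit.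
Unset Printing Implicit Defensive.

(** Put Q = 1/q.  Both identities compare |Omega_M^{T,T'}| with a closed formula,
    so everything rests on counting |Omega_M| and |Omega^{T,T'}|; the final
    identity then follows because every triple has exactly one relative position
    and exactly one pair of Jordan tableaux.

    Omega_M: count pairs (x, N) with x a basis adapted to both flags.  Every basis
    whose vectors are labelled by the boxes of M determines a pair of flags in
    position M; given x, the rows of x N range freely over the spaces F_{i-1} ∩
    F'_{j-1}, and the number of bases adapted to a given pair depends only on M.

    Omega^{T,T'}: sum over N of Jordan type lambda.  The same double count, with
    bases adapted to the flag of the kernels of N^i, counts these N.  For fixed N
    the flags F with JF(N;F) = T are built from the top: the choices of V with
    U N ⊆ V ⊆ U and V of prescribed type are the subspaces in prescribed position
    with respect to the chain (U ∩ ker N^i) + U N, which are counted one step of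
    the chain at a time. *)

(** * Counting by fibres and by successive choices *)

(** The numbers |Omega_M^{T,T'}| themselves are never evaluated: they are the common numerator of
    [pM] and [ptM], so each identity amounts to a closed formula for one denominator. For |Omega_M|
    it reads |Omega_M| Q^(n(alpha)+n(beta)+n) prod [M_ij]_q! = Q^(n^2) [n]_q!. The same two powers
    of Q occur for |Omega^{T,T'}|, and their quotient is the power of q in the statement.

    The counts live in Q while the statement speaks of q = 1/Q; the bridge is Q^(u+m) - Q^(u+s) =
    Q^(u+m) (1-q) [m-s]_q. Some numbers of choices are known only as quotients, so the counting
    lemmas carry multipliers (|S| a = |R| b) instead of divisions.

    Flags are built downwards because, for given U, the number of admissible V depends only on the
    two types, whereas the number of U above a given V also depends on how V sits in the whole
    space. *)

Lemma card_fibre_mulr (K : pzSemiRingType) (X Y : finType) (S : {set X}) (R : {set Y})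
    (h : X -> Y) (a b : K) :
  (forall x, x \in S -> h x \in R) ->
  (forall y, y \in R -> #|[set x in S | h x == y]|%:R * a = b) ->
  #|S|%:R * a = #|R|%:R * b.
Proof.
move=> hS hR; rewrite -[in LHS]sum1_card (partition_big h (mem R)) //= natr_sum mulr_suml.
rewrite mulr_natl -sumr_const; apply: eq_bigr => y yR.
rewrite -(hR y yR) -[in RHS]sum1_card; congr (_%:R * _).
by apply: eq_bigl => x; rewrite inE.
Qed.

Lemma card_fibre_mul (X Y : finType) (S : {set X}) (R : {set Y}) (h : X -> Y) a b :
  (forall x, x \in S -> h x \in R) ->
  (forall y, y \in R -> (#|[set x in S | h x == y]| * a)%N = b) ->
  (#|S| * a = #|R| * b)%N.
Proof.
move=> hS hR; rewrite -[in LHS](natn #|S|) -[in RHS](natn #|R|).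
by apply: (card_fibre_mulr hS) => y yR; rewrite -(hR y yR) natn.
Qed.

Lemma card_fibre (X Y : finType) (S : {set X}) (R : {set Y}) (h : X -> Y) c :
  (forall x, x \in S -> h x \in R) ->
  (forall y, y \in R -> #|[set x in S | h x == y]| = c) ->
  #|S| = (#|R| * c)%N.
Proof.
move=> hS hR; rewrite -[LHS]muln1; apply: (card_fibre_mul hS) => y yR.
by rewrite hR ?muln1.
Qed.

Section SeqChoice.
Variables (I T : finType) (x0 : T) (key : I -> nat).
Hypothesis key_inj : injective key.
Variables (P : I -> {ffun I -> T} -> bool) (K : comPzSemiRingType) (D N : I -> K).
Hypothesis P_local : forall i (f g : {ffun I -> T}),
  (forall j, (key j <= key i)%N -> f j = g j) -> P i f = P i g.

Definition upd (f : {ffun I -> T}) i x := [ffun j => if j == i then x else f j].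

Hypothesis P_card : forall i f,
  (forall j, (key j < key i)%N -> P j f) -> #|[set x | P i (upd f i x)]|%:R * D i = N i.

(** Values are chosen in the order of [key]. By [P_local] the test at [i] sees only what has been
    chosen up to then, and by [P_card] the number of choices there does not depend on the earlier
    ones, so the counts multiply. *)
Lemma card_seq_choice : #|[set f | [forall i, P i f]]|%:R * \prod_i D i = \prod_i N i.
Proof.
(* Partial choices are encoded as total functions with the default [x0] wherever the key is at least
   [t]. Thus [S 0] is a singleton, and [S t] is the set to be counted once [t] exceeds all keys. *)
pose S t := [set f : {ffun I -> T} |
  [forall i, (key i < t)%N ==> P i f] && [forall i, (t <= key i)%N ==> (f i == x0)]].
suff main t : #|S t|%:R * \prod_(i | (key i < t)%N) D i = \prod_(i | (key i < t)%N) N i.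
  pose b := (\max_i key i).+1; have kb i : (key i < b)%N.
    by rewrite ltnS; apply: leq_bigmax.
  have := main b; rewrite (eq_bigl xpredT) // [RHS](eq_bigl xpredT) // => <-; congr (#|pred_of_set _|%:R * _).
  apply/setP=> f; rewrite !inE; apply/forallP/andP.
    by move=> h; split; apply/forallP=> i; rewrite ?h ?implybT // leqNgt kb.
  by case=> /forallP h _ i; have := h i; rewrite kb.
elim: t => [|t IH].
  rewrite !big_pred0 // (_ : S 0%N = [set [ffun=> x0]]) ?cards1 ?mulr1 //.
  apply/setP=> f; rewrite !inE; apply/andP/eqP.
    by case=> _ /forallP h; apply/ffunP=> i; rewrite ffunE; exact/eqP/h.
  by move=> ->; split; apply/forallP=> i; rewrite ?ltn0 // ffunE eqxx implybT.
have [/existsP[i /eqP ki]|/existsPn nok] := boolP [exists i, key i == t]; last first.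
  have -> : S t.+1 = S t.
    apply/setP=> f; rewrite !inE; congr andb; apply: eq_forallb => i.
      by rewrite ltnS leq_eqVlt (negbTE (nok i)).
    by rewrite [in RHS]leq_eqVlt (eq_sym t) (negbTE (nok i)).
  have e i : (key i < t.+1)%N = (key i < t)%N by rewrite ltnS leq_eqVlt (negbTE (nok i)).
  by rewrite (eq_bigl _ _ e) [RHS](eq_bigl _ _ e).
have neq j : (key j == t) = (j == i) by rewrite -ki; apply/eqP/eqP=> [/key_inj|->].
have ke j : (key j < t.+1)%N && (j != i) = (key j < t)%N.
  by rewrite -neq ltnS [in RHS]ltn_neqAle andbC.
rewrite (bigD1 i) ?[RHS](bigD1 i) /= ?ki // (eq_bigl _ _ ke) [in RHS](eq_bigl _ _ ke) -IH.
rewrite mulrA [RHS]mulrCA; rewrite [RHS]mulrA; congr (_ * _).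
(* Resetting the value at [i] to the default maps [S t.+1] to [S t]; the fibre over [f] is the set
   of admissible values at [i]. *)
apply: (card_fibre_mulr (h := fun f => upd f i x0)).
  move=> f; rewrite !inE => /andP[/forallP h1 /forallP h2]; apply/andP; split.
    apply/forallP=> j; apply/implyP=> jt.
    rewrite (P_local (g := f)); first by have := h1 j; rewrite ltnS ltnW.
    by move=> j' jj; rewrite ffunE -neq; case: eqP => // e; lia.
  apply/forallP=> j; apply/implyP=> jt; rewrite ffunE -neq; case: (eqVneq (key j) t) => // e.
  by have := h2 j; rewrite (_ : (t < key j)%N) //; rewrite ltn_neqAle jt andbT eq_sym.
move=> f; rewrite !inE => /andP[/forallP h1 /forallP h2].
have Pf j : (key j < key i)%N -> P j f by rewrite ki => kj; have := h1 j; rewrite kj.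
rewrite -(P_card Pf) -(card_imset (f := fun x => upd f i x)); last first.
  by move=> x y /ffunP/(_ i); rewrite !ffunE eqxx.
have fi : f i = x0 by apply/eqP; have := h2 i; rewrite ki leqnn.
congr (#|pred_of_set _|%:R * _); apply/setP=> g; rewrite !inE; apply/idP/imsetP.
  case/andP=> /andP[/forallP g1 /forallP g2] /eqP gf; exists (g i).
    rewrite inE (P_local (g := g)); first by have := g1 i; rewrite ki ltnSn.
    by move=> j _; rewrite !ffunE; case: eqP => [->//|/eqP ne]; rewrite -gf ffunE (negbTE ne).
  by apply/ffunP=> j; rewrite ffunE; case: eqP => [->//|/eqP ne]; rewrite -gf ffunE (negbTE ne).
case=> x; rewrite inE => Px ->; apply/andP; split; last first.
  by apply/eqP/ffunP=> j; rewrite !ffunE; case: eqP => // ->; rewrite fi.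
apply/andP; split; apply/forallP=> j; apply/implyP.
  rewrite ltnS leq_eqVlt neq => /orP[/eqP->//|kj].
  rewrite (P_local (g := f)); first by apply: Pf; rewrite ki.
  by move=> j' jj; rewrite ffunE -neq; case: eqP => // e; lia.
move=> kj; rewrite ffunE -neq; case: (eqVneq (key j) t) => [e|_]; first by lia.
by have := h2 j; rewrite ltnW.
Qed.
End SeqChoice.

(** The disjoint union of the ['I_(m b)] has [n] elements, and its enumeration carries the tags over
    to ['I_n]. This labels the rows of a square matrix by the boxes of M or by the parts of
    [lam]. *)
Lemma block_assignment (B : finType) (m : B -> nat) n :
  (\sum_b m b)%N = n -> exists c : 'I_n -> B, forall b, #|[set r | c r == b]| = m b.
Proof.
move=> sm; pose S := {b : B & 'I_(m b)}.
have cS : #|{: S}| = n by rewrite card_tagged sumnE big_map big_enum -sm /=; apply: eq_bigr => b _; rewrite card_ord.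
exists (fun r => tag (enum_val (cast_ord (esym cS) r) : S)) => b.
rewrite -[RHS]card_ord -(card_imset (f := fun s : 'I_(m b) => cast_ord cS (enum_rank (Tagged (fun b => 'I_(m b)) s)))); last first.
  by move=> s s' /cast_ord_inj/enum_rank_inj/eqP; rewrite eq_Tagged => /eqP.
apply: eq_card => r; rewrite inE; apply/idP/imsetP => [/eqP e|[s _ ->]]; last first.
  by rewrite cast_ordK enum_rankK.
move: e; case ex : (enum_val _) => [b' s] /= e; case: _ / e; exists s => //.
by apply: (@cast_ord_inj _ _ (esym cS)); apply: enum_val_inj; rewrite cast_ordK enum_rankK ex.
Qed.

(** The rows of a block may be interleaved with others, but a factor sees only how many rows of its
    own block come earlier, and these numbers run through 0, 1, 2, ... without gaps. *)
Lemma prod_rank_block n (P : pred 'I_n) (f : nat -> nat) :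
  (\prod_(r | P r) f #|[set s : 'I_n | (s < r)%N && P s]| =
   \prod_(s < #|[set r | P r]|) f s)%N.
Proof.
suff main t : (\prod_(r < n | P r && (r < t)%N) f #|[set s : 'I_n | (s < r)%N && P s]| =
   \prod_(s < #|[set r : 'I_n | P r && (r < t)%N]|) f s)%N.
  have := main n; rewrite (eq_bigl P) => [->|r]; last by rewrite ltn_ord andbT.
  rewrite (_ : [set r : 'I_n | P r && (r < n)%N] = [set r | P r]) //.
  by apply/setP=> r; rewrite !inE ltn_ord andbT.
elim: t => [|t IH].
  rewrite big_pred0 => [|r]; last by rewrite ltn0 andbF.
  rewrite (_ : [set _ | _] = set0) ?cards0 ?big_ord0 //.
  by apply/setP=> r; rewrite !inE ltn0 andbF.
have [/existsP[r0 /andP[Pr /eqP rt]]|/existsPn nok] := boolP [exists r : 'I_n, P r && (r == t :> nat)].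
  have e r : P r && (r < t.+1)%N && (r != r0) = P r && (r < t)%N.
    by rewrite -andbA; congr andb; rewrite -rt -val_eqE /= ltnS andbC -ltn_neqAle.
  rewrite (bigD1 r0) /=; last by rewrite Pr rt ltnSn.
  rewrite (eq_bigl _ _ e) IH.
  have -> : [set r : 'I_n | P r && (r < t.+1)%N] = r0 |: [set r : 'I_n | P r && (r < t)%N].
    apply/setP=> r; rewrite !inE ltnS leq_eqVlt -{1}rt val_eqE.
    by case: eqP => [->|_] /=; rewrite ?Pr // .
  rewrite cardsU1 inE rt ltnn andbF /= add1n big_ord_recr /= mulnC; congr (_ * f _)%N.
  by apply: eq_card => r; rewrite !inE andbC.
have e r : P r && (r < t.+1)%N = P r && (r < t)%N.
  by rewrite ltnS leq_eqVlt; have := nok r; case: (P r) => //= /negbTE ->.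
rewrite (eq_bigl _ _ e) IH (_ : [set r : 'I_n | P r && (r < t.+1)%N] = [set r : 'I_n | P r && (r < t)%N]) //.
by apply/setP=> r; rewrite !inE e.
Qed.

(** * Row spaces and rows free block by block *)

Section RowCount.
Variables (F : finFieldType).
Notation Q := #|F|.

Lemma card_rV_sub m n (A : 'M[F]_(m, n)) : #|[set v : 'rV_n | (v <= A)%MS]| = (Q ^ \rank A)%N.
Proof.
rewrite -[\rank A]mul1n -card_mx -(card_imset (f := fun u : 'rV_(\rank A) => u *m row_base A)); last first.
  exact/row_free_inj/row_base_free.
apply: eq_card => v; rewrite inE -(eq_row_base A); apply/submxP/imsetP.
  by case=> u ->; exists u.
by case=> u _ ->; exists u.
Qed.

Lemma card_rV_diff m1 m2 n (U : 'M[F]_(m1, n)) (A : 'M[F]_(m2, n)) : (A <= U)%MS ->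
  #|[set v : 'rV_n | (v <= U)%MS && ~~ (v <= A)%MS]| = (Q ^ \rank U - Q ^ \rank A)%N.
Proof.
move=> AU; rewrite -!card_rV_sub.
have -> : [set v : 'rV_n | (v <= U)%MS && ~~ (v <= A)%MS] =
    [set v : 'rV_n | (v <= U)%MS] :\: [set v : 'rV_n | (v <= A)%MS].
  by apply/setP=> v; rewrite !inE andbC.
rewrite cardsD; congr subn; apply: eq_card => v; rewrite !inE andbC.
by case: (boolP (v <= A)%MS) => //= vA; rewrite (submx_trans vA AU).
Qed.

Lemma rank_add_row m n (A : 'M[F]_(m, n)) (v : 'rV_n) : ~~ (v <= A)%MS ->
  \rank (A + v)%MS = (\rank A).+1.
Proof.
move=> vA; apply/eqP; rewrite eqn_leq; apply/andP; split.
  by rewrite (leq_trans (mxrank_adds_leqif A v)) // -[X in (_ <= X)%N]addn1 leq_add2l rank_leq_row.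
have := ltn_leqif (mxrank_leqif_sup (addsmxSl A v)); rewrite ltnNge => ->.
by rewrite addsmx_sub submx_refl.
Qed.

Definition rowsel m n (P : pred 'I_m) (g : 'M[F]_(m, n)) : 'M_(m, n) :=
  \matrix_i (if P i then row i g else 0).

Lemma row_rowsel m n (P : pred 'I_m) (g : 'M[F]_(m, n)) i :
  row i (rowsel P g) = if P i then row i g else 0.
Proof. by rewrite rowK. Qed.

Lemma rowsel_subP m p n (P : pred 'I_m) (g : 'M[F]_(m, n)) (A : 'M_(p, n)) :
  reflect (forall i, P i -> (row i g <= A)%MS) (rowsel P g <= A)%MS.
Proof.
apply: (iffP row_subP) => h i; first by move=> Pi; have := h i; rewrite row_rowsel Pi.
by rewrite row_rowsel; case: ifP => [/h//|_]; rewrite sub0mx.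
Qed.

Lemma row_sub_rowsel m n (P : pred 'I_m) (g : 'M[F]_(m, n)) i :
  P i -> (row i g <= rowsel P g)%MS.
Proof. by move=> Pi; apply/(rowsel_subP P g (rowsel P g)). Qed.

Lemma eq_rowsel m n (P P' : pred 'I_m) (g g' : 'M[F]_(m, n)) :
  P =1 P' -> (forall i, P i -> row i g = row i g') -> rowsel P g = rowsel P' g'.
Proof.
move=> e eg; apply/row_matrixP=> i; rewrite !row_rowsel -e.
by case: ifP => // /eg.
Qed.

Lemma rowsel_sub m n (P P' : pred 'I_m) (g : 'M[F]_(m, n)) :
  subpred P P' -> (rowsel P g <= rowsel P' g)%MS.
Proof. by move=> s; apply/rowsel_subP=> i /s; apply: row_sub_rowsel. Qed.

Lemma rowsel_split m n (P P1 P2 : pred 'I_m) (g : 'M[F]_(m, n)) :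
  (forall i, P i = P1 i || P2 i) -> (rowsel P g :=: rowsel P1 g + rowsel P2 g)%MS.
Proof.
move=> e; apply/eqmxP/andP; split.
  apply/rowsel_subP=> i; rewrite e => /orP[]/row_sub_rowsel h.
    exact: submx_trans (h _ g) (addsmxSl _ _).
  exact: submx_trans (h _ g) (addsmxSr _ _).
by rewrite addsmx_sub !rowsel_sub // => i; rewrite /= e => ->; rewrite ?orbT.
Qed.

Section Blocks.
Variables (m n : nat) (B : eqType) (c : 'I_m -> B) (U W : B -> 'M[F]_n) (t : pred B).
Hypothesis WU : forall b, t b -> (W b <= U b)%MS.

Definition blk (b : B) (r : nat) : pred 'I_m := [pred s : 'I_m | (s < r)%N && (c s == b)].

(* Row r lies in U_b, b = c r, and, when t b holds, is independent modulo W_b of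
   the earlier rows of its own block; different blocks do not interact. *)
Definition block_row (g : 'M[F]_(m, n)) (r : 'I_m) : bool :=
  (row r g <= U (c r))%MS &&
  (t (c r) ==> ~~ (row r g <= W (c r) + rowsel (blk (c r) r) g)%MS).

Definition block_free (g : 'M[F]_(m, n)) : bool := [forall r, block_row g r].

Lemma block_rank g b k : t b -> (k <= m)%N -> (forall r : 'I_m, (r < k)%N -> block_row g r) ->
  \rank (W b + rowsel (blk b k) g)%MS = (\rank (W b) + #|[set s | blk b k s]|)%N.
Proof.
move=> tb; elim: k => [|k IH] km h.
  rewrite (_ : [set _ | _] = set0) ?cards0 ?addn0; last by apply/setP=> s; rewrite !inE.
  apply: eqmx_rank; apply/andP; split; last exact: addsmxSl.
  by rewrite addsmx_sub submx_refl; apply/rowsel_subP.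
have {}IH := IH (ltnW km) (fun r rk => h r (ltnW rk)).
pose r := Ordinal km.
have e s : blk b k.+1 s = blk b k s || (s == r) && (c r == b).
  rewrite /blk /= ltnS leq_eqVlt -val_eqE /=; case: eqP => [e|_] /=; last by rewrite orbF.
  by rewrite e ltnn /= (_ : s = r) //; apply: val_inj.
have := h r (leqnn _); rewrite /block_row.
have [crb|crb] := eqVneq (c r) b; last first.
  move=> _; rewrite (_ : [set _ | _] = [set s | blk b k s]); last first.
    by apply/setP=> s; rewrite !inE; have := e s; rewrite (negbTE crb) andbF orbF.
  by rewrite (eq_rowsel (P' := blk b k) (g' := g)) // => s; rewrite e (negbTE crb) andbF orbF.
rewrite crb tb /= => /andP[_ nr].
have -> : [set s | blk b k.+1 s] = r |: [set s | blk b k s].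
  by apply/setP=> s; rewrite !in_set e crb eqxx andbT orbC in_set1.
rewrite cardsU1 inE /blk /= ltnn /= addnCA -IH add1n -(rank_add_row nr).
rewrite (adds_eqmx (eqmx_refl (W b)) (rowsel_split g e)) addsmxA.
suff E : (rowsel (fun s => (s == r) && (c r == b)) g :=: row r g)%MS.
  by rewrite (adds_eqmx (eqmx_refl _) E).
apply/eqmxP/andP; split; last by apply: row_sub_rowsel; rewrite /blk /= crb !eqxx.
by apply/rowsel_subP=> s /andP[/eqP-> _].
Qed.

Lemma block_sub g k b : t b -> (forall r : 'I_m, (r < k)%N -> block_row g r) ->
  (W b + rowsel (blk b k) g <= U b)%MS.
Proof.
move=> tb h; rewrite addsmx_sub WU //; apply/rowsel_subP=> s /andP[sk /eqP e].
by have /andP[] := h s sk; rewrite e.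
Qed.

(** Rows are chosen in increasing order of index. Where [t] holds, row [r] must avoid, inside
    [U (c r)], a subspace whose dimension [block_rank] gives whatever the earlier choices were. *)
Lemma card_block_free_seq :
  #|[set g | block_free g]| =
  (\prod_(r < m) if t (c r) then Q ^ \rank (U (c r)) - Q ^ (\rank (W (c r)) + #|[set s | blk (c r) r s]|)
     else Q ^ \rank (U (c r)))%N.
Proof.
pose mx (f : {ffun 'I_m -> 'rV[F]_n}) : 'M_(m, n) := \matrix_i f i.
have mxI : injective mx.
  by move=> f g /row_matrixP e; apply/ffunP=> i; have := e i; rewrite !rowK.
pose P (r : 'I_m) f := block_row (mx f) r.
transitivity #|[set f | [forall r, P r f]]|.
  rewrite -(card_imset _ mxI); apply: eq_card => g; rewrite inE; apply/idP/imsetP.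
    move=> gf; have e : g = mx [ffun i => row i g] by apply/row_matrixP=> i; rewrite rowK ffunE.
    by exists [ffun i => row i g] => //; rewrite inE /P -e.
  by case=> f; rewrite inE => Pf ->.
transitivity (#|[set f | [forall r, P r f]]|%:R * \prod_(r < m) (1 : nat)).
  by rewrite big1 // mulr1 natn.
apply: (card_seq_choice 0 val_inj).
  move=> r f g e; rewrite /P /block_row !rowK (e r) //.
  rewrite (eq_rowsel (P := blk (c r) r) (P' := blk (c r) r) (g' := mx g)) // => s /andP[sr _].
  by rewrite !rowK e // ltnW.
move=> r f h; rewrite mulr1 natn; have nx x (s : 'I_m) : (s < r)%N -> row s (mx (upd f r x)) = row s (mx f).
  by move=> sr; rewrite !rowK ffunE -val_eqE (ltn_eqF sr).
transitivity #|[set x : 'rV_n | (x <= U (c r))%MS && (t (c r) ==> ~~ (x <= W (c r) + rowsel (blk (c r) r) (mx f))%MS)]|.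
  apply: eq_card => x; rewrite !inE /P /block_row rowK ffunE eqxx.
  rewrite (eq_rowsel (P := blk (c r) r) (P' := blk (c r) r) (g' := mx f)) // => s /andP[sr _].
  exact: nx.
case: ifP => tc /=; last by rewrite -card_rV_sub; apply: eq_card => x; rewrite !inE andbT.
rewrite -(block_rank tc (ltnW (ltn_ord r)) h) -card_rV_diff //.
exact: block_sub.
Qed.

End Blocks.

(** All matrix counts are instances. The predicate [t] is [xpredT] for adapted bases, [pred0] for
    images of a basis under a map compatible with two flags, and excludes level 0 for images under a
    nilpotent map. *)
Lemma card_block_free m n (B : finType) (c : 'I_m -> B) (U W : B -> 'M[F]_n) (t : pred B) :
  (forall b, t b -> (W b <= U b)%MS) ->
  #|[set g | block_free c U W t g]| =
  (\prod_b if t b then \prod_(s < #|[set r | c r == b]|) (Q ^ \rank (U b) - Q ^ (\rank (W b) + s))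
     else Q ^ (\rank (U b) * #|[set r | c r == b]|))%N.
Proof.
move=> WU; rewrite card_block_free_seq // (partition_big c predT) //=.
apply: eq_bigr => b _; case: ifP => tb.
  rewrite -(prod_rank_block (fun r => c r == b) (fun s => Q ^ \rank (U b) - Q ^ (\rank (W b) + s))%N); apply: eq_bigr => r /eqP ->; rewrite tb.
  by congr (_ - _ ^ (_ + _))%N; apply: eq_card => s; rewrite !inE.
rewrite (eq_bigr (fun _ => (Q ^ \rank (U b))%N)) => [|r /eqP->]; last by rewrite tb.
by rewrite prod_nat_const expnM; congr expn; apply: eq_card => s; rewrite !inE.
Qed.

End RowCount.

(** * Subspaces in prescribed position with respect to a chain *)

Section Subspaces.
Variables (F : finFieldType).
Notation Q := #|F|.

Lemma rank_rowsel_leq m n (P : pred 'I_m) (g : 'M[F]_(m, n)) :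
  (\rank (rowsel P g) <= #|[set s | P s]|)%N.
Proof.
pose h := \matrix_(i < #|[set s | P s]|) row (enum_val i) g.
apply: leq_trans (rank_leq_row h); apply: mxrankS; apply/rowsel_subP => i Pi.
have iP : i \in [set s | P s] by rewrite inE.
by apply: (eq_row_sub (enum_rank_in iP i)); rewrite rowK enum_rankK_in.
Qed.

(** The case of a single block. Full rank modulo [W] is the same as row-by-row independence: a row
    lying in [W] plus the earlier rows would leave at most [d - 1] rows to produce the rank. *)
Lemma card_indep d n (U W : 'M[F]_n) : (W <= U)%MS ->
  #|[set X : 'M_(d, n) | (X <= U)%MS && (\rank (W + X)%MS == \rank W + d)%N]| =
  (\prod_(s < d) (Q ^ \rank U - Q ^ (\rank W + s)))%N.
Proof.
move=> WU; pose c (_ : 'I_d) := tt.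
have -> : (\prod_(s < d) (Q ^ \rank U - Q ^ (\rank W + s)))%N =
          #|[set g : 'M_(d, n) | block_free c (fun=> U) (fun=> W) xpredT g]|.
  rewrite card_block_free // (big_pred1 tt) => [|[]//] /=.
  have -> : #|[set r | c r == tt]| = d.
    by rewrite -[RHS]card_ord; apply: eq_card => r; rewrite inE.
  by [].
apply: eq_card => g; rewrite !inE; apply/andP/forallP => [[gU /eqP rg] r|h].
  rewrite /block_row (submx_trans (row_sub r g) gU) /=; apply/negP=> hr.
  have : (W + g <= W + rowsel (predC1 r) g)%MS.
    rewrite addsmx_sub addsmxSl; apply/row_subP=> i.
    have [->|ir] := eqVneq i r; last by rewrite (submx_trans (row_sub_rowsel _ _) (addsmxSr _ _)).
    apply: submx_trans hr _; apply: addsmxS => //; apply: rowsel_sub => s /andP[sr _] /=.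
    by apply: contraTneq sr => ->; rewrite ltnn.
  move/mxrankS; rewrite rg => le1; have := leq_trans le1 (mxrank_adds_leqif _ _).
  have := rank_rowsel_leq (predC1 r) g.
  rewrite (_ : [set s | _] = [set~ r]); last by apply/setP=> s; rewrite !inE.
  rewrite cardsC1 card_ord; have := ltn_ord r; lia.
have gU : (g <= U)%MS by apply/row_subP=> r; have /andP[] := h r.
split=> //.
have := block_rank (c := c) (b := tt) (W := fun=> W) (t := xpredT) isT (leqnn d) (fun r _ => h r).
have e : blk c tt d =1 xpredT by move=> s; rewrite /blk /= ltn_ord.
have -> : rowsel (blk c tt d) g = g.
  by apply/row_matrixP=> i; rewrite row_rowsel e.
have -> : #|[set s | blk c tt d s]| = d.
  by rewrite -[RHS]card_ord; apply: eq_card => s; rewrite inE e.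
by move/eqP.
Qed.

(** Double count of the [X] in [A] with [d] rows independent modulo [B], sent to V = U + X. Inside
    V, independence modulo [B] and modulo [U] agree because V ∩ B = U, so the fibre over V is again
    counted by [card_indep]. *)
Lemma card_extensions d n (A B U : 'M[F]_n) : (U <= B)%MS -> (B <= A)%MS ->
  (#|[set V : 'M_n | [&& <<V>>%MS == V, (V <= A)%MS, (V :&: B == U)%MS & \rank V == \rank U + d]%N]|
   * \prod_(s < d) (Q ^ (\rank U + d) - Q ^ (\rank U + s)) =
   \prod_(s < d) (Q ^ \rank A - Q ^ (\rank B + s)))%N.
Proof.
move=> UB BA; rewrite -(card_indep d BA); symmetry.
apply: (card_fibre (h := fun X : 'M[F]_(d, n) => <<(U + X)%MS>>%MS)) => [X|V].
  rewrite !inE => /andP[XA /eqP rX]; rewrite genmx_id eqxx genmxE addsmx_sub XA (submx_trans UB BA) /=.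
  have rUX : (\rank (U + X) = \rank U + d)%N.
    apply/eqP; rewrite eqn_leq; apply/andP; split.
      by apply: leq_trans (mxrank_adds_leqif _ _) _; rewrite leq_add2l rank_leq_row.
    have : (\rank (B + X) <= \rank (B + (U + X)))%N by apply: mxrankS; rewrite addsmxS // addsmxSr.
    rewrite rX; have := mxrank_sum_cap B (U + X)%MS.
    have : (\rank U <= \rank (B :&: (U + X)))%N by apply: mxrankS; rewrite sub_capmx UB addsmxSl.
    lia.
  rewrite mxrank_gen rUX eqxx andbT.
  have sub : (U <= <<(U + X)%MS>> :&: B)%MS by rewrite sub_capmx UB genmxE addsmxSl.
  rewrite andbC sub /= -(geq_leqif (mxrank_leqif_sup sub)).
  have := mxrank_sum_cap <<(U + X)%MS>>%MS B; rewrite genmxE rUX.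
  have -> : \rank (<<(U + X)%MS>> + B) = (\rank B + d)%N.
    rewrite -rX; apply: eqmx_rank; apply/andP; split; rewrite addsmx_sub.
      by rewrite genmxE addsmx_sub addsmxSr addsmxSl andbT (submx_trans UB (addsmxSl _ _)).
    by rewrite addsmxSr /= (submx_trans _ (addsmxSl _ _)) // genmxE addsmxSr.
  by lia.
rewrite inE => /and4P[/eqP Vc VA /eqmxP VB /eqP rV].
have UV : (U <= V)%MS by rewrite -VB capmxSl.
rewrite -rV -card_indep //; apply: eq_card => X; rewrite !inE.
apply/andP/andP=> [[/andP[XA /eqP rX] /eqP e]|[XV /eqP rX]].
  have eV : (U + X :=: V)%MS by rewrite -e; apply/eqmx_sym/genmxE.
  by rewrite -{1}eV addsmxSr eV rV.
have eV : (U + X == V)%MS.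
  by rewrite -(mxrank_leqif_eq (_ : U + X <= V)%MS) ?rX ?rV // addsmx_sub UV.
split; last by rewrite -[X in _ == X]Vc; apply/eqP/genmxP.
rewrite (submx_trans XV VA) /=.
have : \rank (B + X)%MS = \rank (B + V)%MS.
  apply: eqmx_rank; apply/andP; split; first by rewrite addsmxS.
  rewrite -(adds_eqmx (eqmx_refl B) (eqmxP eV)) addsmx_sub addsmxSl addsmx_sub addsmxSr andbT.
  exact: submx_trans UB (addsmxSl _ _).
have := mxrank_sum_cap V B; rewrite VB rV addsmxC.
by move=> h ->; apply/eqP; lia.
Qed.

Definition chain_rel n (A : nat -> 'M[F]_n) (d : nat -> nat) m (V : 'M[F]_n) :=
  [&& <<V>>%MS == V, (A 0 <= V)%MS, (V <= A m)%MS &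
    [forall i : 'I_m.+1, \rank (V :&: A i)%MS == \rank (A 0) + \sum_(j < i) d j]]%N.

(** The map V to V ∩ A_m shortens the chain by one step. Its fibres are the sets of
    [card_extensions], whose size depends only on dimensions. *)
Lemma card_chain_rel n (A : nat -> 'M[F]_n) (d : nat -> nat) m :
  (forall i, (i < m)%N -> (A i <= A i.+1)%MS) ->
  (#|[set V | chain_rel A d m V]|
   * \prod_(i < m) \prod_(s < d i) (Q ^ (\rank (A 0) + \sum_(j < i.+1) d j)
        - Q ^ (\rank (A 0) + \sum_(j < i) d j + s)) =
   \prod_(i < m) \prod_(s < d i) (Q ^ \rank (A i.+1) - Q ^ (\rank (A i) + s)))%N.
Proof.
elim: m => [|m IH] hA.
  rewrite !big_ord0 muln1 (_ : [set V | _] = [set <<A 0>>%MS]) ?cards1 //.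
  apply/setP=> V; rewrite !inE; apply/idP/eqP=> [/and4P[/eqP Vc VA AV _]|->].
    by rewrite -[LHS]Vc; apply/genmxP; rewrite AV.
  rewrite /chain_rel genmx_id eqxx !genmxE submx_refl /=; apply/forallP=> i.
  rewrite (ord1 i) big_ord0 addn0; apply/eqP/eqmx_rank.
  by rewrite capmxSr sub_capmx submx_refl genmxE submx_refl.
have {}IH := IH (fun i im => hA i (ltnW im)).
have A0 i : (i <= m)%N -> (A 0%N <= A i)%MS.
  by elim: i => // i IHi im; apply: submx_trans (IHi (ltnW im)) (hA i _); lia.
have Am i : (i <= m)%N -> (A i <= A m)%MS.
  move=> im; have : exists j, (i + j = m)%N by exists (m - i)%N; lia.
  case=> j; elim: j i {im} => [|j IHj] i e; first by rewrite -e addn0.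
  by apply: submx_trans (hA i _) (IHj _ _); lia.
set K := (\prod_(s < d m) (Q ^ (\rank (A 0) + \sum_(j < m.+1) d j) - Q ^ (\rank (A 0) + \sum_(j < m) d j + s)))%N.
set K' := (\prod_(s < d m) (Q ^ \rank (A m.+1) - Q ^ (\rank (A m) + s)))%N.
rewrite big_ord_recr /= -/K [RHS]big_ord_recr /= -/K' -IH.
suff main : (#|[set V | chain_rel A d m.+1 V]| * K = #|[set V | chain_rel A d m V]| * K')%N.
  by rewrite mulnCA main mulnCA mulnA.
apply: (card_fibre_mul (h := fun V => <<V :&: A m>>%MS)) => [V|U].
  rewrite !inE => /and4P[/eqP Vc AV VA /forallP hV].
  rewrite /chain_rel genmx_id eqxx !genmxE sub_capmx AV (A0 m) //= capmxSr /=.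
  apply/forallP=> i; rewrite -(eqP (hV (widen_ord (leqnSn _) i))) /=; apply/eqP/eqmx_rank.
  have im : (A i <= A m)%MS by apply: Am; rewrite -ltnS ltn_ord.
  rewrite !sub_capmx !genmxE !capmxSr !andbT (submx_trans (capmxSl _ _)) ?genmxE ?capmxSl //=.
  by rewrite sub_capmx capmxSl (submx_trans (capmxSr _ _)).
rewrite inE => /and4P[/eqP Uc AU UA /forallP hU].
have rU : (\rank U = \rank (A 0) + \sum_(j < m) d j)%N.
  rewrite -(eqP (hU ord_max)) /=; apply: eqmx_rank.
  by rewrite sub_capmx submx_refl UA capmxSl.
have := card_extensions (d m) UA (hA m (ltnSn m)).
rewrite rU /K /K' big_ord_recr /= addnA => <-; congr muln; apply: eq_card => V; rewrite !inE.
apply/andP/and4P=> [[/and4P[/eqP Vc AV VA /forallP hV] /eqP e]|[/eqP Vc VA /eqmxP e /eqP rV]].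
  split=> //; first exact/eqP.
    by rewrite -e; apply/eqmxP/eqmx_sym/genmxE.
  have := eqP (hV ord_max); rewrite /= big_ord_recr /= addnA => <-; apply/eqP/eqmx_rank.
  by rewrite sub_capmx submx_refl VA capmxSl.
split; last by apply/eqP; rewrite -[RHS]Uc; apply/eq_genmx.
have UV : (U <= V)%MS by rewrite -e capmxSl.
apply/and4P; split=> //; [exact/eqP|exact: submx_trans UV|].
apply/forallP=> i; have [im|im] := ltnP i m.+1.
  have := eqP (hU (Ordinal im)); rewrite /= => <-; apply/eqP/eqmx_rank.
  rewrite !sub_capmx !capmxSr !andbT (submx_trans (capmxSl _ _) UV) andbT.
  by rewrite -e sub_capmx capmxSl (submx_trans (capmxSr _ _) (Am _ _)).
have -> : nat_of_ord i = m.+1 by apply/eqP; rewrite eqn_leq im -ltnS ltn_ord.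
rewrite big_ord_recr /= addnA -rV; apply/eqP/eqmx_rank.
by rewrite sub_capmx submx_refl VA capmxSl.
Qed.

End Subspaces.

(** * Powers of Q and q-factorials *)

Section QCount.
Variable Q : nat.
Hypothesis Q1 : (1 < Q)%N.
Notation q := ((Q%:R : rat)^-1).

Lemma natQ_neq0 : (Q%:R : rat) != 0.
Proof. by rewrite pnatr_eq0 -lt0n ltnW. Qed.

Lemma natQX_neq0 e : (Q%:R : rat) ^+ e != 0.
Proof. exact: expf_neq0 natQ_neq0. Qed.

Lemma qint_gt0 m : 0 < qint q m.+1.
Proof.
rewrite /qint big_ord_recl expr0 ltr_pwDl ?ltr01 // sumr_ge0 // => i _.
by rewrite exprn_ge0 // invr_ge0 ler0n.
Qed.

Lemma qfact_neq0 m : qfact q m != 0.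
Proof. by apply/prodf_neq0 => i _; rewrite gt_eqF // qint_gt0. Qed.

Lemma subq1_neq0 : 1 - q != 0.
Proof.
rewrite subr_eq0 eq_sym invr_eq1; apply/negP => /eqP e.
have /eqP : (Q%:R : rat) = 1%:R by [].
by rewrite eqr_nat => /eqP eQ; move: Q1; rewrite eQ.
Qed.

Lemma qfactS m : qfact q m.+1 = qfact q m * qint q m.+1.
Proof. by rewrite /qfact big_ord_recr. Qed.

Lemma natQ_sub u m s : (s < m)%N ->
  ((Q ^ (u + m) - Q ^ (u + s))%N%:R : rat) = Q%:R ^+ (u + m) * (1 - q) * qint q (m - s).
Proof.
move=> sm; rewrite natrB; last by rewrite leq_exp2l // leq_add2l ltnW.
have e : 1 - q ^+ (m - s) = (1 - q) * qint q (m - s).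
  by rewrite -{1}(expr1n _ (m - s)) subrXX; congr (_ * _); apply: eq_bigr => i _; rewrite expr1n mul1r.
rewrite -mulrA -e mulrBr mulr1 !natrX; congr (_ - _).
rewrite exprVn; apply: (mulIf (natQX_neq0 (m - s))).
by rewrite mulfVK ?natQX_neq0 // -exprD -addnA subnKC // ltnW.
Qed.

(** The q-integers [m], ..., [m-d+1] multiply to [m]_q!/[m-d]_q!. The case [d = m] gives orders of
    linear groups, smaller [d] the q-binomials. *)
Lemma prod_natQ_sub u m d : (d <= m)%N ->
  ((\prod_(s < d) (Q ^ (u + m) - Q ^ (u + s)))%N%:R : rat) * qfact q (m - d) =
  Q%:R ^+ ((u + m) * d) * (1 - q) ^+ d * qfact q m.
Proof.
elim: d => [|d IH] dm; first by rewrite big_ord0 muln0 !expr0 subn0 !mul1r.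
have h (a b c x y w z t : rat) : a * (b * c) = y * w * z -> a * (x * t * c) * b = x * y * (t * w) * z.
  by move=> h; rewrite (_ : a * _ * b = x * t * (a * (b * c))); [rewrite h|]; ring.
rewrite big_ord_recr /= natrM natQ_sub // mulnS [in RHS]exprD [in RHS]exprS.
have e : (m - d = (m - d.+1).+1)%N by lia.
apply: h; rewrite -(IH (ltnW dm)); congr (_ * _).
by rewrite e qfactS.
Qed.

End QCount.

(** * Stable subspaces of prescribed Jordan type *)

Lemma bin2D a b : 'C(a + b, 2) = ('C(a, 2) + 'C(b, 2) + a * b)%N.
Proof.
elim: a => [|a IH]; first by rewrite bin0n addn0.
by rewrite addSn !binS IH !bin1 mulSn; lia.
Qed.

(* The term H m * lam m makes the identity provable by induction; it vanishes once
   lam m = 0. *)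
Lemma strip_exponent (lam mu : nat -> nat) m :
  (forall i, mu i <= lam i)%N -> (forall i, lam i.+1 <= mu i)%N ->
  let H i := (\sum_(j < i) (lam j - mu j))%N in
  (\sum_(i < m) (mu i - lam i.+1) * H i.+1 + \sum_(i < m) 'C(mu i, 2) + 'C(H m, 2)
    + H m * lam m = \sum_(i < m) 'C(lam i, 2))%N.
Proof.
move=> ml lm H; elim: m => [|m IH]; first by rewrite /H !big_ord0.
rewrite big_ord_recr [in X in (_ + X + _ + _)%N]big_ord_recr [RHS]big_ord_recr /= -IH.
have -> : H m.+1 = (H m + (lam m - mu m))%N by rewrite /H big_ord_recr.
rewrite bin2D; move: (ml m) (lm m) => h1 h2.
set h := (lam m - mu m)%N; have -> : lam m = (mu m + h)%N by rewrite /h subnKC.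
rewrite bin2D; set d := (mu m - lam m.+1)%N; have -> : mu m = (d + lam m.+1)%N by rewrite /d subnK.
set A := (\sum_(_ < _) _)%N; set B := (\sum_(_ < _) _)%N.
nia.
Qed.

Section Step.
Variables (F : finFieldType) (n : nat) (N : 'M[F]_n).
Notation Q := #|F|.
Notation q := ((#|F|%:R : rat)^-1).

Lemma mulmx_exprS i : N *m N ^+ i = N ^+ i.+1.
Proof. by rewrite exprS. Qed.

Lemma ker_pow_mulr (V : 'M[F]_n) i :
  ((V :&: kermx (N ^+ i.+1)) *m N :=: V *m N :&: kermx (N ^+ i))%MS.
Proof.
apply/eqmxP/andP; split.
  rewrite sub_capmx submxMr ?capmxSl // sub_kermx -mulmxA mulmx_exprS.
  by rewrite -sub_kermx capmxSr.
apply/rV_subP=> v; rewrite sub_capmx => /andP[/submxP[w ->]].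
rewrite sub_kermx mulmxA -mulmxA mulmx_exprS -sub_kermx => wk.
by apply: submxMr; rewrite sub_capmx submxMl.
Qed.

(** Rank-nullity for N on V ∩ ker N^(i+1). In terms of types: passing from V to V N removes the
    first part. *)
Lemma rank_image_ker_pow (V : 'M[F]_n) i :
  (\rank (V *m N :&: kermx (N ^+ i))%MS + \rank (V :&: kermx (N ^+ 1))%MS =
   \rank (V :&: kermx (N ^+ i.+1))%MS)%N.
Proof.
rewrite -ker_pow_mulr -(mxrank_mul_ker (V :&: kermx (N ^+ i.+1))%MS N); congr addn.
apply: eqmx_rank; apply/andP; split; rewrite !sub_capmx expr1.
  rewrite capmxSl capmxSr !andbT /= sub_kermx.
  have : (V :&: kermx N <= kermx N)%MS by exact: capmxSr.
  by rewrite sub_kermx -mulmx_exprS mulmxA => /eqP->; rewrite mul0mx.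
by rewrite capmxSr andbT (submx_trans (capmxSl _ _)) ?capmxSl.
Qed.

Lemma ker_pow0 (V : 'M[F]_n) : (V :&: kermx (N ^+ 0))%MS = 0.
Proof. by apply/eqP; rewrite -submx0 (submx_trans (capmxSr _ _)) // submx0 kermx_eq0 expr0 row_free_unit unitmx1. Qed.

Variables (U : 'M[F]_n) (lam mu : nat -> nat).
Hypothesis UN : (U *m N <= U)%MS.
Hypothesis Uker : (U <= kermx (N ^+ n))%MS.
Hypothesis rU : forall i, \rank (U :&: kermx (N ^+ i))%MS = (\sum_(j < i) lam j)%N.
Hypotheses (lamn : lam n = 0%N) (mul : forall i, (mu i <= lam i)%N)
  (lamu : forall i, (lam i.+1 <= mu i)%N).

Let L i := (\sum_(j < i) lam j)%N.
Let S i := (\sum_(j < i) mu j)%N.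
Let K i := (U :&: kermx (N ^+ i))%MS.
(* V contains U N, so its type can be read off its intersections with this chain. *)
Let A i := (K i + U *m N)%MS.
Let d i := (mu i - lam i.+1)%N.

Lemma rank_ker1 : \rank (U :&: kermx N)%MS = lam 0.
Proof.
have -> : lam 0%N = (\sum_(j < 1) lam j)%N by rewrite big_ord1.
by rewrite -rU expr1.
Qed.

Lemma rank_image_ker i : (\rank (U *m N :&: kermx (N ^+ i))%MS + lam 0 = L i.+1)%N.
Proof. by rewrite /L -rU -rank_image_ker_pow expr1 rank_ker1. Qed.

Lemma rank_image : (\rank (U *m N) + lam 0 = L n)%N.
Proof.
rewrite /L -rank_ker1 mxrank_mul_ker -rU; apply: eqmx_rank.
by rewrite capmxSl sub_capmx submx_refl Uker.
Qed.

(** K_i ∩ U N = U N ∩ ker N^i has dimension L_(i+1) - lam_0 and U N has dimension L_n - lam_0, so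
    the sum K_i + U N has dimension L_n - (L_(i+1) - L_i). *)
Lemma rank_step_chain i : (\rank (A i) + lam i = L n)%N.
Proof.
have := mxrank_sum_cap (K i) (U *m N); rewrite -/(A i) rU -/(L i).
have -> : \rank (K i :&: U *m N)%MS = \rank (U *m N :&: kermx (N ^+ i))%MS.
  apply: eqmx_rank; apply/andP; split; rewrite !sub_capmx.
    by rewrite capmxSr (submx_trans (capmxSl _ _)) ?capmxSr.
  by rewrite capmxSl capmxSr (submx_trans (capmxSl _ _) UN).
have := rank_image_ker i; have := rank_image.
have -> : L i.+1 = (L i + lam i)%N by rewrite /L big_ord_recr.
lia.
Qed.

(** Since V contains U N, the modular law gives V ∩ A_i = (V ∩ ker N^i) + U N. The two ranks
    therefore differ by a quantity that does not involve V. *)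
Lemma rank_cap_step_chain (V : 'M[F]_n) i : (U *m N <= V)%MS -> (V <= U)%MS ->
  (\rank (V :&: A i)%MS + L i.+1 = \rank (V :&: kermx (N ^+ i))%MS + L n)%N.
Proof.
move=> NV VU; rewrite /A -(matrix_modr _ NV).
have e : (V :&: K i :=: V :&: kermx (N ^+ i))%MS.
  apply/eqmxP/andP; split; rewrite !sub_capmx capmxSl /=.
    by rewrite (submx_trans (capmxSr _ _)) ?capmxSr.
  by rewrite capmxSr (submx_trans (capmxSl _ _) VU).
rewrite (adds_eqmx e (eqmx_refl _)).
have := mxrank_sum_cap (V :&: kermx (N ^+ i))%MS (U *m N).
have -> : \rank (V :&: kermx (N ^+ i) :&: U *m N)%MS = \rank (U *m N :&: kermx (N ^+ i))%MS.
  apply: eqmx_rank; apply/andP; split; rewrite !sub_capmx.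
    by rewrite capmxSr (submx_trans (capmxSl _ _)) ?capmxSr.
  by rewrite capmxSl capmxSr (submx_trans (capmxSl _ _) NV).
have := rank_image_ker i; have := rank_image; lia.
Qed.

Definition step_set := [set V : 'M[F]_n | [&& <<V>>%MS == V, (U *m N <= V)%MS, (V <= U)%MS &
  [forall i : 'I_n.+1, \rank (V :&: kermx (N ^+ i))%MS == S i]]].

Lemma step_chain0 : (A 0 :=: U *m N)%MS.
Proof. by rewrite /A /K ker_pow0; apply: adds0mx. Qed.

Lemma step_chain_top : (A n :=: U)%MS.
Proof.
apply/eqmxP/andP; split; first by rewrite addsmx_sub capmxSl.
by rewrite (submx_trans _ (addsmxSl _ _)) // sub_capmx submx_refl.
Qed.

Lemma step_setE : step_set = [set V | chain_rel A d n V].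
Proof.
apply/setP=> V; rewrite !inE /chain_rel step_chain0 step_chain_top; congr andb.
case: (boolP (U *m N <= V)%MS) => //= NV; case: (boolP (V <= U)%MS) => //= VU.
apply: eq_forallb => i; have h := rank_cap_step_chain i NV VU.
have h0 := rank_step_chain 0.
(* The sum of [d j = mu j - lam j.+1] telescopes against [S] and [L]; this matches the prescribed
   kernel dimension [S i] with the rank that [chain_rel] prescribes. *)
have e : (S i + lam 0 = L i.+1 + \sum_(j < i) d j)%N.
  rewrite /S /L /d; elim: (nat_of_ord i) => [|m IH]; first by rewrite !big_ord0 big_ord1 addn0.
  rewrite !big_ord_recr /= in IH *; have := lamu m; lia.
by set sd := (\sum_(j < i) d j)%N in e *; apply/eqP/eqP; lia.
Qed.

(** Each step of the chain contributes a q-binomial times a power of Q; [strip_exponent] adds up the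
    exponents. *)
Lemma card_step_set :
  #|step_set|%:R * Q%:R ^+ (\sum_(i < n) 'C(mu i, 2) + 'C(\sum_(i < n) (lam i - mu i), 2)) =
  Q%:R ^+ (\sum_(i < n) 'C(lam i, 2)) *
  \prod_(i < n) qbinom q (lam i - lam i.+1) (lam i - mu i).
Proof.
have Q1 := card_finNzRing_gt1 F; have Q0 := natQX_neq0 Q1.
have As i : (A i <= A i.+1)%MS.
  rewrite addsmxS // sub_capmx capmxSl (submx_trans (capmxSr _ _)) // sub_kermx.
  have -> : N ^+ i.+1 = N ^+ i *m N by rewrite exprSr.
  by rewrite mulmxA mulmx_ker mul0mx.
have := congr1 (fun x : nat => x%:R : rat) (card_chain_rel d (fun i (_ : (i < n)%N) => As i)).
rewrite -step_setE natrM !natr_prod.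
pose H i := (\sum_(j < i) (lam j - mu j))%N.
pose a' i := (\rank (A 0) + \sum_(j < i) d j)%N.
have da i : a' i.+1 = (a' i + d i)%N by rewrite /a' big_ord_recr addnA.
(* [a' i] is the prescribed dimension of V ∩ A_i, so [H i.+1], the number of boxes of the strip in
   the first i+1 rows, is the codimension of V ∩ A_(i+1) in A_(i+1). It is the source of the factor
   Q^(d_i H_(i+1)). *)
have rA' i : \rank (A i.+1) = (a' i.+1 + H i.+1)%N.
  have e : (H i.+1 + \sum_(j < i.+1) d j + lam i.+1 = lam 0)%N.
    rewrite /H; elim: i.+1 => [|m IH]; first by rewrite !big_ord0.
    rewrite !big_ord_recr /= /d; move: (mul m) (lamu m) IH; rewrite /d.
    by set x := (\sum_(j < m) (lam j - mu j))%N; set y := (\sum_(j < m) _)%N; lia.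
  move: (rank_step_chain i.+1) (rank_step_chain 0) e; rewrite /a'.
  by set y := (\sum_(j < i.+1) d j)%N; lia.
have step i : (\prod_(s < d i) (Q ^ \rank (A i.+1) - Q ^ (\rank (A i) + s)))%N%:R =
   (\prod_(s < d i) (Q ^ a' i.+1 - Q ^ (a' i + s)))%N%:R *
   (Q%:R ^+ (d i * H i.+1) * qbinom q (lam i - lam i.+1) (lam i - mu i)).
  have hi := mul i; have ui := lamu i.
  have dr : \rank (A i.+1) = (\rank (A i) + (lam i - lam i.+1))%N.
    by move: (rank_step_chain i.+1) (rank_step_chain i); lia.
  have h1 := prod_natQ_sub Q1 (a' i) (leqnn (d i)).
  have dm : (d i <= lam i - lam i.+1)%N by rewrite /d; lia.
  have h2 := prod_natQ_sub Q1 (\rank (A i)) dm.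
  move: h1 h2; rewrite -da -dr /qbinom subnn.
  have -> : (lam i - lam i.+1 - d i = lam i - mu i)%N by rewrite /d; lia.
  have -> : (lam i - lam i.+1 - (lam i - mu i) = d i)%N by rewrite /d; lia.
  rewrite {1}/qfact big_ord0 mulr1 => -> h2. apply: (mulIf (qfact_neq0 #|F| (lam i - mu i))).
  rewrite h2 rA' mulnDl exprD [(H _ * _)%N]mulnC.
  have alg (x y t u v c : rat) : u != 0 -> v != 0 ->
    x * y * t * c = x * t * v * (y * (c / (u * v))) * u.
    by move=> u0 v0; field; rewrite u0 v0.
  by apply: alg; apply: qfact_neq0.
rewrite [X in _ = X](eq_bigr _ (fun i _ => step (nat_of_ord i))) big_split /= mulrC.
move/mulfI => -> //; last first.
  apply/prodf_neq0 => i _.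
  have h1 := prod_natQ_sub Q1 (a' i) (leqnn (d i)); move: h1.
  rewrite subnn {1}/qfact big_ord0 mulr1 -da /a' => ->.
  by rewrite !mulf_neq0 ?expf_neq0 ?subq1_neq0 ?qfact_neq0 // natQ_neq0.
(* As [lam n = 0], the correction term [H n * lam n] of [strip_exponent] vanishes here. *)
rewrite big_split /= -expr_sum -(strip_exponent n mul lamu) lamn muln0 addn0 -addnA [in RHS]exprD.
by rewrite mulrAC.
Qed.
End Step.

(** * Flags with a prescribed Jordan tableau *)

Lemma psumS k (a : 'I_k -> nat) (j : 'I_k) : psum a j.+1 = (psum a j + a j)%N.
Proof.
rewrite /psum (bigD1 j) //= addnC; congr addn; apply: eq_bigl => i.
by rewrite ltnS [in RHS]ltn_neqAle -val_eqE andbC.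
Qed.

Lemma psum_all k (a : 'I_k -> nat) : psum a k = (\sum_j a j)%N.
Proof. by apply: eq_bigl => j; rewrite ltn_ord. Qed.

Lemma psum0 k (a : 'I_k -> nat) : psum a 0 = 0%N.
Proof. exact: big_pred0. Qed.

Lemma pent_ord n (lam : partT n) (r : 'I_n) : pent lam r = lam r.
Proof. by rewrite /pent valK. Qed.

Lemma pent_out n (lam : partT n) r : (n <= r)%N -> pent lam r = 0%N.
Proof. by move=> nr; rewrite /pent insubF // ltnNge nr. Qed.

Lemma sum_pent n (lam : partT n) : (\sum_(r < n) pent lam r = \sum_(r < n) (lam r : nat))%N.
Proof. by apply: eq_bigr => r _; rewrite pent_ord. Qed.

Lemma sum_tail0 (f : nat -> nat) n i : (forall r, (n <= r)%N -> f r = 0%N) -> (n <= i)%N ->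
  (\sum_(r < i) f r = \sum_(r < n) f r)%N.
Proof.
move=> f0; elim: i => [|i IH]; first by rewrite leqn0 => /eqP ->.
rewrite leq_eqVlt => /orP[/eqP<-//|ni].
by rewrite big_ord_recr /= IH // f0 // addn0.
Qed.

Section Flags.
Variables (F : finFieldType) (n : nat) (N : 'M[F]_n).
Notation Q := #|F|.
Notation q := ((#|F|%:R : rat)^-1).

Lemma ker_pow_sub i j : (i <= j)%N -> (kermx (N ^+ i) <= kermx (N ^+ j))%MS.
Proof.
move=> /subnKC <-; rewrite sub_kermx.
have -> : N ^+ (i + (j - i)) = N ^+ i *m N ^+ (j - i) by rewrite exprD.
by rewrite mulmxA mulmx_ker mul0mx.
Qed.

(** The cumulative form of the condition in [jf_eq]: kernel dimensions themselves instead of their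
    truncated differences. *)
Definition jf_shape (V : 'M[F]_n) (lam : partT n) : bool :=
  [forall i : 'I_n.+1, \rank (V :&: kermx (N ^+ i))%MS == \sum_(j < i) pent lam j]%N.

Lemma jf_shapeP (V : 'M[F]_n) (lam : partT n) :
  [forall r : 'I_n, (lam r : nat) ==
     (\rank (V :&: kermx (N ^+ r.+1))%MS - \rank (V :&: kermx (N ^+ r))%MS)%N] =
  jf_shape V lam.
Proof.
have mono i : (\rank (V :&: kermx (N ^+ i)) <= \rank (V :&: kermx (N ^+ i.+1)))%N.
  by apply/mxrankS/capmxS => //; apply: ker_pow_sub.
apply/forallP/forallP => h i.
  apply/eqP; case: i => i /=; elim: i => [|i IH] ni.
    by rewrite big_ord0 ker_pow0 mxrank0.
  rewrite big_ord_recr /= -IH ?(ltnW ni) //.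
  have := eqP (h (Ordinal (ni : (i < n)%N))); rewrite -pent_ord /= => ->.
  by rewrite subnKC.
have /eqP -> := h (lift ord0 i); have /eqP := h (widen_ord (leqnSn n) i).
rewrite /= => ->; rewrite big_ord_recr /= pent_ord.
by apply/eqP; set x := (\sum_(_ < _) _)%N; lia.
Qed.

Lemma jf_eqE k (f : flagT F n k) (T : tabT n k) :
  jf_eq f N T = [forall j, jf_shape (f j) (T j)].
Proof. by apply: eq_forallb => j; apply: jf_shapeP. Qed.

Lemma jf_shape_ker V lam : jf_shape V lam -> (\sum_(r < n) (lam r : nat) = \rank V)%N ->
  (V <= kermx (N ^+ n))%MS.
Proof.
move=> /forallP/(_ ord_max)/eqP /= h s; rewrite -sum_pent -h in s.
have := mxrank_leqif_sup (capmxSl V (kermx (N ^+ n))); case=> _; rewrite s eqxx.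
by move=> /esym/submx_trans; apply; apply: capmxSr.
Qed.

Lemma jf_shape_rank V lam i : jf_shape V lam -> (\sum_(r < n) (lam r : nat) = \rank V)%N ->
  \rank (V :&: kermx (N ^+ i))%MS = (\sum_(j < i) pent lam j)%N.
Proof.
move=> h s; have [ni|ni] := leqP i n; first by have /forallP/(_ (Ordinal (ni : (i < n.+1)%N)))/eqP := h.
rewrite (@sum_tail0 (pent lam) n i (@pent_out n lam)) ?(ltnW ni) // sum_pent s; apply: eqmx_rank.
rewrite capmxSl sub_capmx submx_refl /=; apply: submx_trans (jf_shape_ker h s) _.
exact/ker_pow_sub/ltnW.
Qed.

Section FixedType.
Variables (k : nat) (a : 'I_k -> nat) (lam : partT n) (T : tabT n k).
Hypotheses (sa : (\sum_i a i)%N = n) (HT : is_ssyt a lam T) (HN : jf_shape 1%:M lam).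

Let w (j : 'I_k) := widen_ord (leqnSn k) j.
Let s (j : 'I_k) : 'I_k.+1 := lift ord0 j.

Lemma ssyt_sum i : (\sum_(r < n) (T i r : nat) = psum a i)%N.
Proof. by have /andP[/andP[/andP[_ /forallP/(_ i)/andP[_ /eqP]]]] := HT. Qed.

Lemma ssyt_top : T ord_max = lam.
Proof. by have /andP[_ /eqP] := HT. Qed.

Lemma ssyt_strip j r :
  (pent (T (w j)) r <= pent (T (s j)) r)%N /\ (pent (T (s j)) r.+1 <= pent (T (w j)) r)%N.
Proof.
have /andP[/andP[_ /forallP/(_ j)/forallP h]] := HT.
have [rn|nr] := ltnP r n; first by have /andP[] := h (Ordinal rn).
by rewrite !pent_out // ltnW.
Qed.

(** The conditions on a flag, cut into tests that see only [f i] and the step just above it.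
    Stability of [f i] is included because counting the step below, inside [f i], requires it. *)
Let P (i : 'I_k.+1) (f : flagT F n k) : bool :=
  [&& <<f i>>%MS == f i, \rank (f i) == psum a i, (f i *m N <= f i)%MS, jf_shape (f i) (T i) &
   [forall j, (w j == i) ==> (f (s j) *m N <= f i)%MS && (f i <= f (s j))%MS]].

Let C2 i := (\sum_(r < n) 'C(pent (T i) r, 2))%N.
Let D (i : 'I_k.+1) : rat :=
  if insub (i : nat) : option 'I_k is Some j then Q%:R ^+ (C2 i + 'C(a j, 2)) else 1.
Let E (i : 'I_k.+1) : rat :=
  if insub (i : nat) : option 'I_k is Some j then Q%:R ^+ (C2 (s j)) *
    \prod_(r < n) qbinom q (pent (T (s j)) r - pent (T (s j)) r.+1)
             (pent (T (s j)) r - pent (T (w j)) r) else 1.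

Let key (i : 'I_k.+1) := (k - i)%N.

(** With [key i = k - i] the largest step comes first, and each further one is chosen inside its
    predecessor by [card_step_set]. [D] and [E] are the two sides of that lemma. *)
Lemma card_flag_chain :
  #|[set f | [forall i, P i f]]|%:R * \prod_i D i = \prod_i E i.
Proof.
apply: (card_seq_choice (key := key) 0) => [i j|i f g e|i f h].
- by rewrite /key => e; apply: val_inj => /=; move: (ltn_ord i) (ltn_ord j); lia.
- rewrite /P (e i) //; do !congr andb; apply: eq_forallb => j.
  have [wi|] //= := eqVneq (w j) i; rewrite e // -wi /key /= /bump leq0n; lia.
rewrite /D /E; case: insubP => [j jk ij|]; last first.
  (* The top step: having rank [n], it can only be the whole space, whose type is [lam] by [HN]. *)
  rewrite -leqNgt => ki.
  have -> : i = ord_max by apply: val_inj => /=; move: (ltn_ord i); lia.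
  rewrite mulr1 (_ : [set x | _] = [set 1%:M]) ?cards1 //.
  apply/setP=> x; rewrite !inE /P ffunE eqxx /= psum_all sa; apply/idP/eqP => [|->].
    case/and5P=> /eqP xc xr _ _ _; rewrite -xc -(genmx1 F n); apply/genmxP.
    by rewrite submx1 sub1mx.
  rewrite genmx1 eqxx mxrank1 eqxx submx1 ssyt_top HN /=.
  by apply/forallP=> j; rewrite -val_eqE /= ltn_eqF // ltn_ord.
have iw : i = w j by apply: val_inj; rewrite /= ij.
have sk : (key (s j) < key i)%N by rewrite iw /key /= /bump leq0n; have := ltn_ord j; lia.
have /and5P[_ /eqP rU UN shU _] := h _ sk.
have sU : (\sum_(r < n) (T (s j) r : nat) = \rank (f (s j)))%N by rewrite ssyt_sum.
have Uker := jf_shape_ker shU sU.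
have := card_step_set UN Uker (fun i => jf_shape_rank i shU sU) (pent_out _ (leqnn n))
  (fun r => (ssyt_strip j r).1) (fun r => (ssyt_strip j r).2).
rewrite (_ : (\sum_(i < n) (pent (T (s j)) i - pent (T (w j)) i))%N = a j); last first.
  rewrite sumnB; last by move=> r _; case: (ssyt_strip j r).
  by rewrite !sum_pent !ssyt_sum /= /bump leq0n add1n psumS addKn.
rewrite -/(C2 (w j)) -/(C2 (s j)) -iw => <-; congr (_%:R * _).
apply: eq_card => V; rewrite !inE /P ffunE eqxx; apply/and5P/and4P.
  case=> Vc rV VN shV /forallP/(_ j); rewrite -iw eqxx !ffunE.
  have sni : s j != i by apply: contraTneq sk => ->; rewrite ltnn.
  by rewrite (negbTE sni) => /andP[].
have sni : s j != i by apply: contraTneq sk => ->; rewrite ltnn.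
case=> Vc NV VU shV; have VN : (V *m N <= V)%MS by apply: submx_trans (submxMr _ VU) NV.
split=> //; last first.
  apply/forallP=> j'; apply/implyP=> /eqP e; have -> : j' = j.
    by apply: val_inj; have := congr1 val e; rewrite /= ij.
  by rewrite ffunE (negbTE sni) NV.
have /eqP e := forallP shV ord_max; rewrite -ssyt_sum -sum_pent -e /=; apply/eqP/eqmx_rank.
by rewrite capmxSl sub_capmx submx_refl (submx_trans VU).
Qed.

(** The exponents sum_r C(T^(j)_r, 2) telescope from 0 at the empty shape to their value at [lam];
    the terms C(a_j, 2), with a_j the size of the j-th strip, add up to [nfun a]. *)
Lemma card_flags :
  #|[set f | is_flag a f && strict_compat f N && jf_eq f N T]|%:R * Q%:R ^+ nfun a =
  Q%:R ^+ (\sum_(r < n) 'C(pent lam r, 2)) * wtq q T.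
Proof.
have Q0 := natQX_neq0 (card_finNzRing_gt1 F).
have eP : [set f | is_flag a f && strict_compat f N && jf_eq f N T] = [set f | [forall i, P i f]].
  apply/setP=> f; rewrite !inE jf_eqE; apply/andP/forallP => [[/andP[/andP[/forallP h1 /forallP h2] /forallP h3] /forallP h4] i|h].
    have /andP[h11 h12] := h1 i; rewrite /P h11 h12 h4 /=; apply/andP; split; last first.
      by apply/forallP=> j; apply/implyP=> /eqP<-; rewrite h3 h2.
    have [ik|ik] := ltnP i k.
      have -> : i = w (Ordinal ik) by apply: val_inj.
      by apply: submx_trans (h3 _); apply: submxMr.
    have {}ik : nat_of_ord i = k by move: (ltn_ord i); lia.
    have := h12; rewrite ik psum_all sa => fr.
    by rewrite (submx_trans (submx1 _)) // sub1mx.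
  split; last by apply/forallP=> i; case/and5P: (h i).
  rewrite -andbA; apply/and3P; split; apply/forallP=> i.
  - by case/and5P: (h i) => -> ->.
  - by case/and5P: (h (w i)) => _ _ _ _ /forallP/(_ i); rewrite eqxx => /andP[].
  - by case/and5P: (h (w i)) => _ _ _ _ /forallP/(_ i); rewrite eqxx => /andP[].
have := card_flag_chain; rewrite -eP !big_ord_recr /=.
have -> : D ord_max = 1 by rewrite /D insubF // ltnn.
have -> : E ord_max = 1 by rewrite /E insubF // ltnn.
rewrite !mulr1.
rewrite (eq_bigr (fun j : 'I_k => Q%:R ^+ (C2 (w j)) * Q%:R ^+ 'C(a j, 2))); last first.
  by move=> j _; rewrite /D /= valK exprD.
rewrite [RHS](eq_bigr (fun j : 'I_k => Q%:R ^+ (C2 (s j)) * \prod_(r < n) qbinom q (pent (T (s j)) r - pent (T (s j)) r.+1)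
             (pent (T (s j)) r - pent (T (w j)) r))); last first.
  by move=> j _; rewrite /E /= valK.
rewrite !big_split /= -!expr_sum -/(nfun a) -/(wtq q T).
have c0 : C2 ord0 = 0%N.
  apply: big1 => r _; rewrite pent_ord; have /andP[/andP[/andP[/forallP h _] _] _] := HT.
  by rewrite (eqP (h r)).
have cm : C2 ord_max = (\sum_(r < n) 'C(pent lam r, 2))%N by rewrite /C2 ssyt_top.
have tele : (\sum_(j < k) C2 (s j) = \sum_(j < k) C2 (w j) + C2 ord_max)%N.
  by transitivity (\sum_(i < k.+1) C2 i)%N; [rewrite big_ord_recl c0 | rewrite big_ord_recr].
rewrite tele -cm exprD -[X in _ = X -> _]mulrA => h; apply: (mulfI (Q0 (\sum_(j < k) C2 (w j))%N)).
by rewrite mulrCA h.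
Qed.
End FixedType.
End Flags.

(** * Bases and spans of sets of basis vectors *)

Section RowSel.
Variable F : finFieldType.
Notation Q := #|F|.

Lemma rowsel_mul m n p (P : pred 'I_m) (g : 'M[F]_(m, n)) (N : 'M_(n, p)) :
  rowsel P (g *m N) = rowsel P g *m N.
Proof.
apply/row_matrixP=> i; rewrite row_mul !row_rowsel row_mul.
by case: ifP; rewrite ?mul0mx.
Qed.

Lemma rowsel_all m n (P : pred 'I_m) (g : 'M[F]_(m, n)) : P =1 xpredT -> rowsel P g = g.
Proof. by move=> e; apply/row_matrixP=> i; rewrite row_rowsel e. Qed.

Lemma rank_rowsel n (P : pred 'I_n) (g : 'M[F]_n) : g \in unitmx ->
  \rank (rowsel P g) = #|[set s | P s]|.
Proof.
move=> gu; apply/eqP; rewrite eqn_leq rank_rowsel_leq /=.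
have h := rank_rowsel_leq (predC P) g.
have := mxrank_adds_leqif (rowsel P g) (rowsel (predC P) g); case=> + _.
rewrite -(rowsel_split (P := xpredT)) => [|i /=]; last by rewrite orbN.
rewrite rowsel_all // mxrank_unit //.
have := cardsC [set s | P s]; rewrite card_ord.
have -> : ~: [set s | P s] = [set s | predC P s] by apply/setP=> s; rewrite !inE.
move=> e le; rewrite -(leq_add2r #|[set s | predC P s]|) e; apply: leq_trans le _.
by rewrite leq_add2l.
Qed.

Lemma row_notin_rowsel n (P : pred 'I_n) (g : 'M[F]_n) r : g \in unitmx -> ~~ P r ->
  ~~ (row r g <= rowsel P g)%MS.
Proof.
move=> gu Pr; apply/negP=> h.
have : (g <= rowsel (predC1 r) g)%MS.
  apply/row_subP=> i; have [->|ir] := eqVneq i r; last exact: row_sub_rowsel.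
  by apply: submx_trans h _; apply: rowsel_sub => s Ps; apply: contraNneq Pr => <-.
move/mxrankS; rewrite mxrank_unit // rank_rowsel //.
rewrite (_ : [set s | _] = [set~ r]); last by apply/setP=> s; rewrite !inE.
by rewrite cardsC1 card_ord; have := ltn_ord r; lia.
Qed.

(** For subsets of one basis the inclusion from right to left is clear, and the dimensions agree by
    |P1 ∪ P2| + |P1 ∩ P2| = |P1| + |P2|. *)
Lemma rowsel_cap n (P1 P2 : pred 'I_n) (g : 'M[F]_n) : g \in unitmx ->
  (rowsel P1 g :&: rowsel P2 g :=: rowsel (predI P1 P2) g)%MS.
Proof.
move=> gu; apply/eqmx_sym/eqmxP.
have sub : (rowsel (predI P1 P2) g <= rowsel P1 g :&: rowsel P2 g)%MS.
  by rewrite sub_capmx !rowsel_sub // => s /andP[].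
rewrite -(mxrank_leqif_eq sub) rank_rowsel //.
have := mxrank_sum_cap (rowsel P1 g) (rowsel P2 g).
rewrite -(rowsel_split (P := predU P1 P2)) // !rank_rowsel //.
have := cardsUI [set s | P1 s] [set s | P2 s].
have -> : [set s | P1 s] :|: [set s | P2 s] = [set s | predU P1 P2 s] by apply/setP=> s; rewrite !inE.
have -> : [set s | P1 s] :&: [set s | P2 s] = [set s | predI P1 P2 s] by apply/setP=> s; rewrite !inE.
by move=> <- /addnI ->.
Qed.

(** A nonzero coefficient at [r] would express row [r] through [W] and the other selected rows, and
    the rank would be too small. *)
Lemma indep_coef m n p (P : pred 'I_m) (Y : 'M[F]_(m, n)) (W : 'M[F]_(p, n)) (u : 'rV_m) :
  \rank (W + rowsel P Y)%MS = (\rank W + #|[set s | P s]|)%N ->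
  (u *m rowsel P Y <= W)%MS -> forall r, P r -> u 0 r = 0.
Proof.
move=> rk uW r Pr; apply/eqP/negP=> /negP ur.
have rY : (row r Y <= W + rowsel (predD1 P r) Y)%MS.
  move: uW; rewrite mulmx_sum_row (bigD1 r) //= row_rowsel Pr => uW.
  rewrite -(eqmx_scale _ ur) -[_ *: _](addrK (\sum_(i | i != r) u 0 i *: row i (rowsel P Y))).
  rewrite addmx_sub_adds // -scaleN1r scalemx_sub //; apply: summx_sub => i ir.
  rewrite scalemx_sub // row_rowsel; case: ifP => Pi; last exact: sub0mx.
  by apply: row_sub_rowsel; rewrite /= ir.
have : (W + rowsel P Y <= W + rowsel (predD1 P r) Y)%MS.
  rewrite addsmx_sub addsmxSl; apply/rowsel_subP=> i Pi.
  have [->//|ir] := eqVneq i r.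
  by rewrite (submx_trans _ (addsmxSr _ _)) //; apply: row_sub_rowsel; rewrite /= ir.
move/mxrankS; rewrite rk; apply/negP; rewrite -ltnNge.
apply: leq_ltn_trans (mxrank_adds_leqif _ _) _; rewrite ltn_add2l.
apply: leq_ltn_trans (rank_rowsel_leq _ _) _; apply: proper_card; apply/properP.
split; first by apply/subsetP=> s; rewrite !inE => /andP[].
by exists r; rewrite !inE ?eqxx.
Qed.

Lemma card_unitmx n : #|[set g : 'M[F]_n | g \in unitmx]| = (\prod_(s < n) (Q ^ (0 + n) - Q ^ (0 + s)))%N.
Proof.
have h : ((0 : 'M[F]_n) <= (1%:M : 'M_n))%MS by exact: sub0mx.
have := card_indep n h.
rewrite mxrank1 mxrank0 => <-; apply: eq_card => g; rewrite !inE submx1 adds0mx.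
by rewrite -row_free_unit.
Qed.

Lemma natr_card_unitmx n : (#|[set g : 'M[F]_n | g \in unitmx]|%:R : rat) =
  Q%:R ^+ (n * n) * (1 - (Q%:R)^-1) ^+ n * qfact (Q%:R)^-1 n.
Proof.
rewrite card_unitmx; have := prod_natQ_sub (card_finNzRing_gt1 F) 0 (leqnn n).
by rewrite subnn {1}/qfact big_ord0 mulr1 => ->; rewrite add0n.
Qed.
End RowSel.

(** * Bases adapted to the kernel flag *)

Section Nilpotent.
Variables (F : finFieldType) (n : nat) (lam : partT n) (c : 'I_n -> 'I_n).
Notation Q := #|F|.
Notation q := ((#|F|%:R : rat)^-1).
Hypotheses (Hlam : is_partition lam) (Hc : forall b, #|[set r | c r == b]| = lam b).

Let L i := (\sum_(j < i) pent lam j)%N.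

Lemma level_count i : (i <= n)%N -> #|[set r | (c r < i)%N]| = L i.
Proof.
elim: i => [|i IH] ni; first by rewrite /L big_ord0; apply: eq_card0 => r; rewrite !inE.
rewrite /L big_ord_recr /= -/(L i) -(IH (ltnW ni)).
rewrite (pent_ord lam (Ordinal ni)) -Hc -cardsUI.
rewrite [X in (_ + X)%N]eq_card0 ?addn0; last first.
  by move=> r; rewrite !inE -val_eqE /=; apply/negP => /andP[h /eqP e]; rewrite e ltnn in h.
by apply: eq_card => r; rewrite !inE ltnS leq_eqVlt orbC -val_eqE.
Qed.

Lemma sum_lam : (\sum_(r < n) (lam r : nat) = n)%N.
Proof. by have /andP[_ /eqP] := Hlam. Qed.

Lemma lam_nonincr r : (pent lam r.+1 <= pent lam r)%N.
Proof.
have /andP[/forallP h _] := Hlam; have [rn|nr] := ltnP r n; first exact: h (Ordinal rn).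
by rewrite !pent_out // ltnW.
Qed.

Let lev (g : 'M[F]_n) (i : nat) := rowsel (fun r => (c r < i)%N) g.

Lemma lev_mono g i j : (i <= j)%N -> (lev g i <= lev g j)%MS.
Proof. by move=> ij; apply: rowsel_sub => r /= /leq_trans; apply. Qed.

Lemma lev_n g : lev g n = g.
Proof. by apply: rowsel_all => r; rewrite ltn_ord. Qed.

Lemma lev0 g : lev g 0 = 0.
Proof. by apply/row_matrixP=> i; rewrite row_rowsel row0. Qed.

Lemma lev_split g (b : 'I_n) : (lev g b.+1 :=: lev g b + rowsel (blk c b n) g)%MS.
Proof.
apply: rowsel_split => r; rewrite /blk /= ltn_ord /= ltnS leq_eqVlt orbC.
by rewrite -val_eqE.
Qed.

Lemma card_blk b : #|[set s | blk c b n s]| = lam b.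
Proof. by rewrite -Hc; apply: eq_card => s; rewrite !inE /blk /= ltn_ord. Qed.

(** Block [b] has [lam b] rows, the dimension of ker N^(b+1) modulo ker N^b when N has type [lam];
    its rows then complete ker N^b to ker N^(b+1). *)
Definition ker_adapted (N g : 'M[F]_n) :=
  block_free c (fun b : 'I_n => kermx (N ^+ b.+1)) (fun b : 'I_n => kermx (N ^+ b)) xpredT g.

(** Adaptedness expressed without kernels, for Y = g N: a vector of label b goes into the span of
    the smaller labels, and block b stays independent modulo the labels below b-1. Label 0 is sent
    to 0, hence exempt from independence. For fixed [g] this is a condition on [Y] that can be
    counted. *)
Definition strict_levels (g Y : 'M[F]_n) :=
  block_free c (fun b : 'I_n => lev g b) (fun b : 'I_n => lev g b.-1) [pred b : 'I_n | (0 < b)%N] Y.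

Lemma jf_shape1_rank (N : 'M[F]_n) i : jf_shape N 1%:M lam -> \rank (kermx (N ^+ i)) = L i.
Proof.
move=> h; rewrite /L -(jf_shape_rank i h) ?mxrank1 ?sum_lam //; apply: eqmx_rank.
by rewrite capmxSr sub_capmx submx1 submx_refl.
Qed.

Lemma ker_adapted_lev N g i : jf_shape N 1%:M lam -> ker_adapted N g -> (i <= n)%N ->
  (lev g i :=: kermx (N ^+ i))%MS.
Proof.
move=> hN hg; elim: i => [|i IH] ni.
  apply/eqmxP; rewrite lev0 sub0mx /= submx0 kermx_eq0.
  by rewrite expr0 row_free_unit unitmx1.
have {}IH := IH (ltnW ni); pose b := Ordinal ni.
have sub : (lev g b.+1 <= kermx (N ^+ i.+1))%MS.
  rewrite lev_split addsmx_sub IH ker_pow_sub //=; apply/rowsel_subP=> r /andP[_ /eqP e].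
  by have /andP[] := forallP hg r; rewrite e.
apply/eqmxP; rewrite -(mxrank_leqif_eq sub) lev_split (adds_eqmx IH (eqmx_refl _)).
have -> := @block_rank F n n _ c _ _ xpredT g b n isT (leqnn n) (fun r _ => forallP hg r).
by rewrite card_blk /= !(jf_shape1_rank _ hN) /L big_ord_recr /= (pent_ord lam b).
Qed.

Lemma ker_adapted_unit N g : jf_shape N 1%:M lam -> ker_adapted N g -> g \in unitmx.
Proof.
move=> hN hg; rewrite -row_full_unit /row_full -{1}(lev_n g) (ker_adapted_lev hN hg) //.
by rewrite (jf_shape1_rank _ hN) /L sum_pent sum_lam.
Qed.

(** For b > 0, N induces an injection of ker N^(b+1)/ker N^b into ker N^b/ker N^(b-1), so
    independence survives. *)
Lemma ker_adapted_strict N g : jf_shape N 1%:M lam -> ker_adapted N g -> strict_levels g (g *m N).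
Proof.
move=> hN hg; apply/forallP=> r; have /andP[h1 h2] := forallP hg r.
have cn := ltn_ord (c r).
rewrite /block_row row_mul; apply/andP; split.
  rewrite (ker_adapted_lev hN hg) ?(ltnW cn) // sub_kermx -mulmxA mulmx_exprS.
  by rewrite -sub_kermx.
apply/implyP=> /= c0; apply: contra h2.
rewrite (adds_eqmx (ker_adapted_lev hN hg _) (eqmx_refl _)); last by apply: leq_trans (leq_pred _) (ltnW cn).
rewrite rowsel_mul => /sub_addsmxP[[x y] /= e].
rewrite /= -[row r g](subrK (y *m rowsel (blk c (c r) r) g)) addmx_sub_adds ?submxMl //.
rewrite sub_kermx -(prednK c0) -mulmx_exprS mulmxA mulmxBl e -[y *m _ *m N]mulmxA addrK.
by rewrite -mulmxA mulmx_ker mulmx0.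
Qed.

Section Converse.
Variables (N g : 'M[F]_n).
Hypotheses (gu : g \in unitmx) (gN : strict_levels g (g *m N)).

Lemma lev_image i : (lev g i.+1 *m N <= lev g i)%MS.
Proof.
rewrite -rowsel_mul; apply/rowsel_subP=> r; rewrite ltnS => ci.
have /andP[h _] := forallP gN r; exact: submx_trans h (lev_mono _ ci).
Qed.

(** Descent from the whole space: if v lies in level b+1 with b > i, the image of its component of
    label b lies in [lev g b.-1]. Independence of block [b] then makes that component zero. *)
Lemma lev_preimage i (v : 'rV_n) : (v *m N <= lev g i)%MS -> (v <= lev g i.+1)%MS.
Proof.
clear Hlam Hc; move=> vN; suff main j : (i + j < n)%N -> (v <= lev g (i + j).+1)%MS -> (v <= lev g i.+1)%MS.
  have vn : (v <= lev g n)%MS by rewrite lev_n submx_full // row_full_unit.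
  have [ni|ni] := ltnP i n; last exact: submx_trans vn (lev_mono _ (leqW ni)).
  apply: (main (n.-1 - i)%N); first lia.
  by rewrite (_ : (i + _).+1 = n) //; lia.
elim: j => [|j IH]; first by rewrite addn0.
move=> ijn vj; apply: IH; first by lia.
pose b := Ordinal ijn; have b0 : (0 < b)%N by rewrite /= addnS.
have eb : b.-1 = (i + j)%N by rewrite /= addnS.
move: vj; rewrite -[(i + j.+1)%N]/(b : nat) lev_split => /sub_addsmxP[[x y] /= e].
have bE : nat_of_ord b = (i + j).+1 by rewrite /= addnS.
have yN : (y *m rowsel (blk c b n) (g *m N) <= lev g b.-1)%MS.
  rewrite rowsel_mul mulmxA; have -> : y *m rowsel (blk c b n) g = v - x *m lev g b by rewrite e addrC addKr.
  rewrite mulmxBl addmx_sub //; first by apply: submx_trans vN (lev_mono _ _); rewrite eb leq_addr.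
  rewrite -scaleN1r scalemx_sub // -mulmxA mulmx_sub // bE; exact: lev_image.
have rk := @block_rank F n n _ c _ _ _ (g *m N) b n b0 (leqnn n) (fun r _ => forallP gN r).
have y0 := indep_coef rk yN.
suff z : y *m rowsel (blk c b n) g = 0 by rewrite e z addr0 -bE submxMl.
rewrite mulmx_sum_row big1 // => r _; rewrite row_rowsel; case: ifP => Pr; last by rewrite scaler0.
by rewrite y0 ?scale0r.
Qed.

(** By [lev_image] and [lev_preimage], each level is the full preimage under N of the one before,
    just as for the kernels of powers. *)
Lemma lev_ker i : (i <= n)%N -> (lev g i :=: kermx (N ^+ i))%MS.
Proof.
move=> _; apply/eqmxP; elim: i => [|i /andP[IH1 IH2]].
  rewrite lev0 sub0mx /= submx0 kermx_eq0.
  by rewrite expr0 row_free_unit unitmx1.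
apply/andP; split.
  rewrite sub_kermx -mulmx_exprS mulmxA -sub_kermx; exact: submx_trans (lev_image i) IH1.
apply/rV_subP=> v; rewrite sub_kermx -mulmx_exprS mulmxA -sub_kermx => h.
by apply: lev_preimage; apply: submx_trans h IH2.
Qed.

Lemma strict_jf : jf_shape N 1%:M lam.
Proof.
apply/forallP=> i; have ni : (i <= n)%N by rewrite -ltnS ltn_ord.
rewrite -/(L i) -level_count // -(rank_rowsel (fun r => (c r < i)%N) gu) -/(lev g i).
rewrite (lev_ker ni); apply/eqP/eqmx_rank.
by rewrite capmxSr sub_capmx submx1 submx_refl.
Qed.

Lemma strict_adapted : ker_adapted N g.
Proof.
apply/forallP=> r; have cn := ltn_ord (c r).
apply/andP; split; first by rewrite -lev_ker //; apply: row_sub_rowsel.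
apply/implyP=> _; rewrite -(adds_eqmx (lev_ker (ltnW cn)) (eqmx_refl _)).
rewrite -(rowsel_split (P := fun s => (c s < c r)%N || blk c (c r) r s)) //.
by apply: row_notin_rowsel => //; rewrite /blk /= !ltnn.
Qed.
End Converse.

End Nilpotent.

(** * Nilpotent endomorphisms of a given Jordan type *)

Lemma prod_shift (K : comPzSemiRingType) (f : nat -> K) n : f 0%N = f n ->
  \prod_(i < n) f i = \prod_(i < n) f i.+1.
Proof.
case: n => [|n] e; first by rewrite !big_ord0.
by rewrite big_ord_recl e mulrC [RHS]big_ord_recr.
Qed.

Section CardNilpotent.
Variables (F : finFieldType) (n : nat) (lam : partT n).
Notation Q := #|F|.
Notation q := ((#|F|%:R : rat)^-1).
Hypothesis Hlam : is_partition lam.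

Let L i := (\sum_(j < i) pent lam j)%N.

Lemma card_nilpotent_nat :
  (#|[set N : 'M[F]_n | jf_shape N 1%:M lam]| *
    \prod_(b < n) \prod_(s < pent lam b) (Q ^ (L b + pent lam b) - Q ^ (L b + s)) =
   #|[set g : 'M[F]_n | g \in unitmx]| *
    \prod_(b < n) \prod_(s < pent lam b.+1) (Q ^ (L b + pent lam b) - Q ^ (L b + s)))%N.
Proof.
have [c Hc] : exists c : 'I_n -> 'I_n, forall b, #|[set r | c r == b]| = lam b.
  by apply: block_assignment; apply: sum_lam.
have LS b : L b.+1 = (L b + pent lam b)%N by rewrite /L big_ord_recr.
(* The set is described by [g] and g N only. For fixed [g] the product Y = g N determines N; for
   fixed N the admissible [g] are the bases adapted to its kernels. *)
pose S := [set x : 'M[F]_n * 'M[F]_n | (x.1 \in unitmx) && strict_levels c x.1 (x.1 *m x.2)].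
transitivity #|S|; [symmetry|].
  apply: (card_fibre (h := snd)) => [[g N]|N]; rewrite !inE /=.
    by move=> /andP[gu gN]; rewrite (strict_jf Hc gu gN).
  move=> hN; transitivity #|[set g | ker_adapted c N g]|.
    rewrite -(card_imset (f := fun g => (g, N))); last by move=> g g' [].
    apply: eq_card => -[g N']; rewrite !inE /=; apply/idP/imsetP.
      by case/andP=> /andP[gu gN] /eqP e; move: gN; rewrite e => gN; exists g; rewrite ?inE //; apply: (strict_adapted gu gN).
    case=> g'; rewrite inE => hg [-> ->]; rewrite eqxx andbT.
    by rewrite (ker_adapted_unit Hlam Hc hN hg) (ker_adapted_strict Hlam Hc hN hg).
  rewrite card_block_free => [|b _]; last exact: ker_pow_sub.
  apply: eq_bigr => b _ /=; rewrite Hc pent_ord.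
  by rewrite !(jf_shape1_rank Hlam _ hN) -/(L b) -pent_ord -LS.
apply: (card_fibre (h := fst)) => [[g N]|g]; rewrite !inE /=.
  by case/andP.
move=> gu; transitivity #|[set Y | strict_levels c g Y]|.
  have inj : injective (fun Y : 'M[F]_n => (g, invmx g *m Y)).
    by move=> Y Y' /(congr1 (fun x => g *m x.2)) /=; rewrite !mulKVmx.
  rewrite -(card_imset _ inj); apply: eq_card => -[g' N]; rewrite !inE /=; apply/idP/imsetP.
    by case/andP=> /andP[_ h] /eqP e; exists (g *m N); rewrite ?inE -?e // mulKmx // e.
  by case=> Y; rewrite inE => h [-> ->]; rewrite gu mulKVmx // h eqxx.
rewrite card_block_free => [|b _]; last by apply: lev_mono; apply: leq_pred.
have rk b : (b <= n)%N -> \rank (rowsel (fun r => (c r < b)%N) g) = L b.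
  by move=> bn; rewrite rank_rowsel // (level_count Hc).
pose f b := if (0 < b)%N then (\prod_(s < pent lam b) (Q ^ L b - Q ^ (L b.-1 + s)))%N else 1%N.
transitivity (\prod_(b < n) f b)%N.
  apply: eq_bigr => b _; rewrite /= /f Hc -pent_ord !rk ?(ltnW (ltn_ord b)) //; last first.
    exact: leq_trans (leq_pred _) (ltnW (ltn_ord b)).
  by case: (nat_of_ord b) => //=; rewrite /L big_ord0 mul0n.
(* Level 0 contributes 1, and so does index [n] because [pent lam n = 0]; hence the index may be
   moved by one. *)
rewrite (prod_shift (f := f)); last by rewrite /f /=; case: ifP => // _; rewrite pent_out // big_ord0.
by apply: eq_bigr => b _; rewrite /f /= LS.
Qed.

(** Orbit-stabilizer in disguise: the right side is the order of GL_n, and the factor in parentheses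
    is the order of the centralizer of a nilpotent matrix of type [lam]. *)
Lemma card_nilpotent :
  #|[set N : 'M[F]_n | jf_shape N 1%:M lam]|%:R *
    (Q%:R ^+ (\sum_(r < n) pent lam r * pent lam r) * (1 - q) ^+ pent lam 0 * prodLfact q lam) =
  Q%:R ^+ (n * n) * (1 - q) ^+ n * qfact q n.
Proof.
have Q1 := card_finNzRing_gt1 F.
have := congr1 (fun x : nat => x%:R : rat) card_nilpotent_nat.
rewrite !natrM natr_card_unitmx !natr_prod => main.
have sl : (\sum_(r < n) pent lam r)%N = n by rewrite sum_pent sum_lam.
have K1 (b : nat) : (\prod_(s < pent lam b) (Q ^ (L b + pent lam b) - Q ^ (L b + s)))%N%:R =
   Q%:R ^+ (L b * pent lam b + pent lam b * pent lam b) * (1 - q) ^+ pent lam b * qfact q (pent lam b).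
  have := prod_natQ_sub Q1 (L b) (leqnn (pent lam b)).
  by rewrite subnn {1}/qfact big_ord0 mulr1 mulnDl.
have K2 (b : nat) : (\prod_(s < pent lam b.+1) (Q ^ (L b + pent lam b) - Q ^ (L b + s)))%N%:R =
   Q%:R ^+ (L b.+1 * pent lam b.+1) * (1 - q) ^+ pent lam b.+1 * qfact q (pent lam b)
    / qfact q (pent lam b - pent lam b.+1).
  have := prod_natQ_sub Q1 (L b) (lam_nonincr Hlam b).
  have -> : L b.+1 = (L b + pent lam b)%N by rewrite /L big_ord_recr.
  by move=> <-; rewrite mulfK // qfact_neq0.
rewrite (eq_bigr _ (fun b _ => K1 (nat_of_ord b))) [X in _ = _ * X](eq_bigr _ (fun b _ => K2 (nat_of_ord b))) in main.
move: main.
rewrite !big_split /= -!expr_sum sl prodfV -/(prodLfact q lam).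
(* Both ends vanish, by [L 0 = 0] and [pent lam n = 0], so these powers of Q cancel between the two
   sides. *)
have sh : (\sum_(i < n) L i.+1 * pent lam i.+1 = \sum_(i < n) L i * pent lam i)%N.
  have e0 : (L 0 * pent lam 0 = 0)%N by rewrite /L big_ord0.
  have en : (L n * pent lam n = 0)%N by rewrite pent_out // muln0.
  apply: (@addnI (L 0 * pent lam 0)%N); rewrite -[LHS](big_ord_recl n (fun i : 'I_n.+1 => L i * pent lam i)%N).
  by rewrite big_ord_recr /= en e0 addn0.
have sl' : (\sum_(i < n) pent lam i.+1 + pent lam 0 = n)%N.
  rewrite -[RHS]sl addnC -(big_ord_recl n (fun i : 'I_n.+1 => pent lam i)) big_ord_recr /=.
  by rewrite pent_out // addn0.
rewrite sh big_split /= exprD.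
have eb : (1 - q) ^+ n = (1 - q) ^+ (\sum_(i < n) pent lam i.+1)%N * (1 - q) ^+ pent lam 0.
  by rewrite -exprD sl'.
set f := \prod_(i < n) _; set P := prodLfact q lam.
have f0 : f != 0 by apply/prodf_neq0 => i _; apply: qfact_neq0.
have P0 : P != 0 by apply/prodf_neq0 => i _; apply: qfact_neq0.
have A0 := natQX_neq0 Q1 (\sum_(i < n) L i * pent lam i)%N.
have B0 : (1 - q) ^+ (\sum_(i < n) pent lam i.+1)%N != 0 by rewrite expf_neq0 ?subq1_neq0.
have alg (x a y b z f' p g c : rat) : c = b * z -> a != 0 -> b != 0 -> f' != 0 -> p != 0 ->
   x * (a * y * c * f') = g * (a * b * f' * p^-1) -> x * (y * z * p) = g.
  move=> -> a0 b0 ff p0 h; apply: (mulIf (mulf_neq0 (mulf_neq0 a0 b0) ff)).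
  transitivity (x * (a * y * (b * z) * f') * p); first by ring.
  by rewrite h; field.
exact: alg eb A0 B0 f0 P0.
Qed.

End CardNilpotent.

(** * Pairs of flags in a given relative position *)

Lemma psum_add k (a b : 'I_k -> nat) i :
  psum (fun j => a j + b j)%N i = (psum a i + psum b i)%N.
Proof. exact: big_split. Qed.

Lemma eq_psum k (a b : 'I_k -> nat) i : a =1 b -> psum a i = psum b i.
Proof. by move=> e; apply: eq_bigr => j _. Qed.

(** Pairs of elements sorted by the later block they meet: the other element lies in an earlier
    block or in the same one. *)
Lemma psum_bin2 k (m : 'I_k -> nat) i : (i <= k)%N ->
  (\sum_(j < k | (j < i)%N) (m j * psum m j + 'C(m j, 2)) = 'C(psum m i, 2))%N.
Proof.
elim: i => [|i IH] ik; first by rewrite psum0 big_pred0.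
have := psumS (fun j => m j * psum m j + 'C(m j, 2))%N (Ordinal ik); rewrite /psum /= => ->.
rewrite -/(psum m i) -/(psum m i.+1) IH ?(ltnW ik) // (psumS m (Ordinal ik)) /= bin2D.
by rewrite addnAC addnA mulnC addnC addnA addnC; lia.
Qed.

Lemma bump0 i : bump 0 i = i.+1.
Proof. by []. Qed.

Section RelPos.
Variables (F : finFieldType) (n k l : nat) (al : 'I_k -> nat) (be : 'I_l -> nat).
Variables (M : {ffun 'I_k * 'I_l -> 'I_n.+1}) (c : 'I_n -> 'I_k * 'I_l).
Notation Q := #|F|.
Notation q := ((#|F|%:R : rat)^-1).
Hypotheses (sal : (\sum_i al i)%N = n) (sbe : (\sum_j be j)%N = n).
Hypothesis (HM : is_contingency al be M).
Hypothesis Hc : forall b, #|[set r | c r == b]| = M b.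

Let D i j := psum (fun a => psum (fun b => M (a, b) : nat) j) i.

Lemma row_sum i : (\sum_j (M (i, j) : nat) = al i)%N.
Proof. by have /andP[/forallP/(_ i)/eqP] := HM. Qed.

Lemma col_sum j : (\sum_i (M (i, j) : nat) = be j)%N.
Proof. by have /andP[_ /forallP/(_ j)/eqP] := HM. Qed.

Lemma corner0r i : D i 0 = 0%N.
Proof. by apply: big1 => a _; apply: psum0. Qed.

Lemma corner_Sr i (j : 'I_l) : D i j.+1 = (D i j + psum (fun a => M (a, j) : nat) i)%N.
Proof. by rewrite /D -psum_add; apply: eq_psum => a; apply: psumS. Qed.

Lemma corner_Sl (i : 'I_k) j : D i.+1 j = (D i j + psum (fun b => M (i, b) : nat) j)%N.
Proof. exact: psumS. Qed.

Lemma corner_box (i : 'I_k) (j : 'I_l) : (D i.+1 j.+1 + D i j = D i j.+1 + D i.+1 j + M (i, j))%N.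
Proof. by rewrite !corner_Sl (psumS (fun b => M (i, b) : nat) j); clear HM sal sbe Hc; lia. Qed.

Lemma corner_full_r i : D i l = psum al i.
Proof. by apply: eq_psum => a; rewrite psum_all row_sum. Qed.

Lemma corner_full_l j : D k j = psum be j.
Proof.
rewrite /D psum_all /psum exchange_big /=; apply: eq_bigr => b _; exact: col_sum.
Qed.

Lemma corner_full : D k l = n.
Proof. by rewrite corner_full_r psum_all. Qed.

Lemma card_label (P : pred ('I_k * 'I_l)) : #|[set r | P (c r)]| = (\sum_(b | P b) M b)%N.
Proof.
rewrite -sum1_card (partition_big c P) => [|r]; last by rewrite inE.
apply: eq_bigr => b Pb; rewrite -Hc -sum1_card; apply: eq_bigl => r; rewrite !inE.
by case: eqP => [->|]; rewrite ?Pb ?andbF.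
Qed.

Lemma card_box i j : #|[set r | ((c r).1 < i)%N && ((c r).2 < j)%N]| = D i j.
Proof.
rewrite (card_label (fun b => (b.1 < i)%N && (b.2 < j)%N)) /D /psum pair_big /=.
by apply: eq_bigr => -[].
Qed.

Let box (x : 'M[F]_n) i j := rowsel (fun r => ((c r).1 < i)%N && ((c r).2 < j)%N) x.

Definition flag1 (x : 'M[F]_n) : flagT F n k :=
  [ffun i : 'I_k.+1 => <<rowsel (fun r => ((c r).1 < i)%N) x>>%MS].
Definition flag2 (x : 'M[F]_n) : flagT F n l :=
  [ffun j : 'I_l.+1 => <<rowsel (fun r => ((c r).2 < j)%N) x>>%MS].

Lemma card_box1 i : #|[set r | ((c r).1 < i)%N]| = psum al i.
Proof.
rewrite -corner_full_r -card_box; apply: eq_card => r; rewrite !inE.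
by rewrite (ltn_ord (c r).2) andbT.
Qed.

Lemma card_box2 j : #|[set r | ((c r).2 < j)%N]| = psum be j.
Proof.
rewrite -corner_full_l -card_box; apply: eq_card => r; rewrite !inE.
by rewrite (ltn_ord (c r).1).
Qed.

Section Unit.
Variable x : 'M[F]_n.
Hypothesis xu : x \in unitmx.

Lemma flag1_is_flag : is_flag al (flag1 x).
Proof.
apply/andP; split; apply/forallP=> i.
  by rewrite ffunE genmx_id eqxx mxrank_gen rank_rowsel // card_box1 eqxx.
rewrite !ffunE !genmxE rowsel_sub // => r /= h; rewrite /bump leq0n add1n ltnS; exact: ltnW.
Qed.

Lemma flag2_is_flag : is_flag be (flag2 x).
Proof.
apply/andP; split; apply/forallP=> i.
  by rewrite ffunE genmx_id eqxx mxrank_gen rank_rowsel // card_box2 eqxx.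
rewrite !ffunE !genmxE rowsel_sub // => r /= h; rewrite /bump leq0n add1n ltnS; exact: ltnW.
Qed.

Lemma flags_cap i j : (flag1 x i :&: flag2 x j :=: box x i j)%MS.
Proof. by rewrite !ffunE; apply: eqmx_trans (cap_eqmx (genmxE _) (genmxE _)) (rowsel_cap _ _ xu). Qed.

Lemma flags_relpos : relpos (flag1 x) (flag2 x) M.
Proof.
by apply/forallP=> i; apply/forallP=> j; rewrite flags_cap rank_rowsel // card_box.
Qed.

(** With [pred0] the independence test is off and only containments remain: the row labelled (i,j)
    lies in the span of the basis vectors whose labels are smaller in both coordinates. *)
Definition box_lower (Y : 'M[F]_n) :=
  block_free c (fun b => box x b.1 b.2) (fun=> 0) pred0 Y.

(** Compatibility with both flags puts the image of a vector labelled (i,j) into F_(i-1) ∩ F'_(j-1),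
    which by [rowsel_cap] is spanned by basis vectors. *)
Lemma box_lower_compat N :
  box_lower (x *m N) = strict_compat (flag1 x) N && strict_compat (flag2 x) N.
Proof.
apply/forallP/andP => [h|[/forallP h1 /forallP h2] r].
  split; apply/forallP=> i; rewrite !ffunE !genmxE (eqmxMr N (genmxE _)) -rowsel_mul.
    apply/rowsel_subP=> r /=; rewrite /bump leq0n add1n ltnS => ri.
    have /andP[hr _] := h r; apply: submx_trans hr _; apply: rowsel_sub => s /= /andP[h1 _].
    exact: leq_trans h1 ri.
  apply/rowsel_subP=> r /=; rewrite /bump leq0n add1n ltnS => ri.
  have /andP[hr _] := h r; apply: submx_trans hr _; apply: rowsel_sub => s /= /andP[_ h1].
  exact: leq_trans h1 ri.
rewrite /block_row andbT row_mul.
have := rowsel_cap (fun r' => ((c r').1 < (c r).1)%N) (fun r' => ((c r').2 < (c r).2)%N) xu.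
move=> e; rewrite /box -[X in (_ <= X)%MS]/(rowsel (predI _ _) x) -e sub_capmx; apply/andP; split.
  have := h1 (c r).1; rewrite !ffunE !genmxE (eqmxMr N (genmxE _)); apply: submx_trans.
  by apply: submxMr; apply: row_sub_rowsel; rewrite /= /bump leq0n add1n.
have := h2 (c r).2; rewrite !ffunE !genmxE (eqmxMr N (genmxE _)); apply: submx_trans.
by apply: submxMr; apply: row_sub_rowsel; rewrite /= /bump leq0n add1n.
Qed.
End Unit.

Section Pair.
Variables (f : flagT F n k) (g : flagT F n l).
Hypotheses (ff : is_flag al f) (fg : is_flag be g) (fgM : relpos f g M).

Let f0 (i : 'I_k) := f (widen_ord (leqnSn k) i).
Let f1 (i : 'I_k) := f (lift ord0 i).
Let g0 (i : 'I_l) := g (widen_ord (leqnSn l) i).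
Let g1 (i : 'I_l) := g (lift ord0 i).

(** The quotient of [capU b] by [capW b] has dimension [M b]; an adapted basis fills it with the
    block labelled [b]. *)
Definition capU (b : 'I_k * 'I_l) := (f1 b.1 :&: g1 b.2)%MS.
Definition capW (b : 'I_k * 'I_l) := (f0 b.1 :&: g1 b.2 + f1 b.1 :&: g0 b.2)%MS.

Definition pair_adapted (x : 'M[F]_n) := block_free c capU capW xpredT x.

Lemma pair_stepl i : (f0 i <= f1 i)%MS.
Proof. by have /andP[_ /forallP/(_ i)] := ff. Qed.

Lemma pair_stepr i : (g0 i <= g1 i)%MS.
Proof. by have /andP[_ /forallP/(_ i)] := fg. Qed.

Lemma capWU b : (capW b <= capU b)%MS.
Proof. by rewrite addsmx_sub !capmxS ?pair_stepl ?pair_stepr. Qed.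

Lemma rank_cap i j : \rank (f i :&: g j)%MS = D i j.
Proof. by have /forallP/(_ i)/forallP/(_ j)/eqP := fgM. Qed.

Lemma rank_capU b : \rank (capU b) = D b.1.+1 b.2.+1.
Proof. by rewrite rank_cap. Qed.

Lemma rank_capW b : (\rank (capW b) + M b = D b.1.+1 b.2.+1)%N.
Proof.
have := mxrank_sum_cap (f0 b.1 :&: g1 b.2)%MS (f1 b.1 :&: g0 b.2)%MS.
have -> : \rank ((f0 b.1 :&: g1 b.2) :&: (f1 b.1 :&: g0 b.2))%MS = D b.1 b.2.
  rewrite -[RHS](rank_cap (widen_ord (leqnSn k) b.1) (widen_ord (leqnSn l) b.2)).
  apply: eqmx_rank; apply/andP; split; rewrite !sub_capmx.
    by rewrite (submx_trans (capmxSl _ _)) ?capmxSl // (submx_trans (capmxSr _ _)) ?capmxSr.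
  rewrite capmxSl capmxSr (submx_trans (capmxSr _ _) (pair_stepr _)).
  by rewrite (submx_trans (capmxSl _ _) (pair_stepl _)).
rewrite !rank_cap -/(capW b) /= !bump0; have := corner_box b.1 b.2; rewrite -surjective_pairing.
by move: (D _ _) (D _ _) (D _ _) (D _ _) (\rank _); clear HM sal sbe Hc ff fg fgM; lia.
Qed.

Lemma flag_cap0 i j : (i == ord0) || (j == ord0) -> (f i :&: g j)%MS = 0.
Proof.
move=> h; apply/eqP; rewrite -mxrank_eq0 rank_cap; apply/eqP.
by case/orP: h => /eqP ->; [apply: psum0 | apply: corner0r].
Qed.

(** Double induction: the boxes below (p+1,q+1) are those below (p,q+1) or (p+1,q), which span
    [capW], and one new block, whose [M b] vectors raise the rank to that of [capU]. *)
Lemma pair_adapted_box x i j : pair_adapted x -> (f i :&: g j :=: box x i j)%MS.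
Proof.
move=> hx; suff main p q' (Hp : (p < k.+1)%N) (Hq : (q' < l.+1)%N) :
    (f (Ordinal Hp) :&: g (Ordinal Hq) :=: box x p q')%MS.
  by case: i j => p Hp [q' Hq]; apply: main.
elim: p q' Hp Hq => [|p IHp] q' Hp Hq.
  rewrite flag_cap0 // (_ : box x 0 q' = 0) //.
  by apply/row_matrixP=> r; rewrite row_rowsel row0.
elim: q' Hq => [|q' IHq] Hq.
  rewrite flag_cap0 ?orbT // (_ : box x _ 0 = 0) //.
  by apply/row_matrixP=> r; rewrite row_rowsel andbF row0.
pose b : 'I_k * 'I_l := (Ordinal (Hp : (p < k)%N), Ordinal (Hq : (q' < l)%N)).
have eU : (f (Ordinal Hp) :&: g (Ordinal Hq))%MS = capU b.
  by congr (f _ :&: g _)%MS; apply: val_inj.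
have eW : (capW b :=: box x p q'.+1 + box x p.+1 q')%MS.
  apply: adds_eqmx.
    have := IHp q'.+1 (ltnW Hp) Hq; set X := (_ :&: _)%MS; set Y := (f0 _ :&: _)%MS.
    by rewrite (_ : X = Y) //; congr (f _ :&: g _)%MS; apply: val_inj.
  have := IHq (ltnW Hq); set X := (_ :&: _)%MS; set Y := (f1 _ :&: _)%MS.
  by rewrite (_ : X = Y) //; congr (f _ :&: g _)%MS; apply: val_inj.
have eB : (box x p.+1 q'.+1 :=: (box x p q'.+1 + box x p.+1 q') + rowsel (blk c b n) x)%MS.
  apply: eqmx_trans (rowsel_split (P1 := fun r => ((c r).1 < p)%N && ((c r).2 < q'.+1)%N
     || ((c r).1 < p.+1)%N && ((c r).2 < q')%N) (P2 := blk c b n) x _) _.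
    move=> r; rewrite /blk /= ltn_ord /= -pair_eqE /= -!val_eqE /=; clear; lia.
  by apply: adds_eqmx (eqmx_refl _); apply: rowsel_split.
rewrite eU; apply/eqmx_sym/eqmxP.
have sub : (box x p.+1 q'.+1 <= capU b)%MS.
  rewrite eB -(adds_eqmx eW (eqmx_refl _)) addsmx_sub capWU.
  by apply/rowsel_subP=> r /andP[_ /eqP e]; have /andP[] := forallP hx r; rewrite e.
rewrite -(mxrank_leqif_eq sub) eB -(adds_eqmx eW (eqmx_refl _)).
have -> := @block_rank F n n _ c capU capW xpredT x b n isT (leqnn n) (fun r _ => forallP hx r).
have -> : #|[set s | blk c b n s]| = M b.
  by rewrite -Hc; apply: eq_card => s; rewrite !inE /blk /= ltn_ord.
by rewrite rank_capW rank_capU.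
Qed.

Lemma flag_top_f : (1%:M <= f ord_max)%MS.
Proof.
have /andP[/forallP/(_ ord_max)/andP[_ /eqP h] _] := ff.
by rewrite sub1mx /row_full h /= psum_all sal.
Qed.

Lemma flag_top_g : (1%:M <= g ord_max)%MS.
Proof.
have /andP[/forallP/(_ ord_max)/andP[_ /eqP h] _] := fg.
by rewrite sub1mx /row_full h /= psum_all sbe.
Qed.

Lemma pair_adapted_unit x : pair_adapted x -> x \in unitmx.
Proof.
move=> hx; rewrite -row_full_unit /row_full.
have e : (f ord_max :&: g ord_max :=: x)%MS.
  apply: eqmx_trans (pair_adapted_box _ _ hx) _.
  by rewrite /box rowsel_all // => r; rewrite /= !ltn_ord.
by rewrite -e rank_cap /= corner_full.
Qed.

Lemma pair_adapted_flags x : pair_adapted x -> flag1 x = f /\ flag2 x = g.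
Proof.
move=> hx; split; apply/ffunP=> i; rewrite ffunE.
  have /andP[/forallP/(_ i)/andP[/eqP <- _] _] := ff; apply/eq_genmx/eqmx_sym.
  apply: (eqmx_trans (B := (f i :&: g ord_max)%MS)).
    apply/eqmxP; rewrite capmxSl andbT sub_capmx submx_refl.
    exact: submx_trans (submx1 _) flag_top_g.
  apply: eqmx_trans (pair_adapted_box _ _ hx) _.
  by rewrite /box (eq_rowsel (P' := fun r => ((c r).1 < i)%N) (g' := x)) // => r; rewrite /= ltn_ord andbT.
have /andP[/forallP/(_ i)/andP[/eqP <- _] _] := fg; apply/eq_genmx/eqmx_sym.
apply: (eqmx_trans (B := (f ord_max :&: g i)%MS)).
  apply/eqmxP; rewrite capmxSr andbT sub_capmx submx_refl andbT.
  exact: submx_trans (submx1 _) flag_top_f.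
apply: eqmx_trans (pair_adapted_box _ _ hx) _.
by rewrite /box (eq_rowsel (P' := fun r => ((c r).2 < i)%N) (g' := x)) // => r; rewrite /= ltn_ord.
Qed.

End Pair.

(** The converse of [pair_adapted_flags]: the bases inducing a given pair of flags are exactly the
    bases adapted to it. *)
Lemma flags_adapted x : x \in unitmx -> pair_adapted (flag1 x) (flag2 x) x.
Proof.
move=> xu; apply/forallP=> r; rewrite /block_row /capU /capW.
rewrite (flags_cap xu) (adds_eqmx (adds_eqmx (flags_cap xu _ _) (flags_cap xu _ _)) (eqmx_refl _)).
apply/andP; split; first by apply: row_sub_rowsel; rewrite /= /bump leq0n !ltnSn.
apply/implyP=> _; rewrite -(adds_eqmx (rowsel_split (P := fun s =>
  ((c s).1 < (c r).1)%N && ((c s).2 < bump 0 (c r).2)%N || ((c s).1 < bump 0 (c r).1)%N && ((c s).2 < (c r).2)%N) x _) (eqmx_refl _)) //.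
rewrite -(rowsel_split (P := fun s => (((c s).1 < (c r).1)%N && ((c s).2 < bump 0 (c r).2)%N || ((c s).1 < bump 0 (c r).1)%N && ((c s).2 < (c r).2)%N) || blk c (c r) r s)) //.
by apply: row_notin_rowsel => //; rewrite /blk /= !ltnn andbF.
Qed.

End RelPos.

(** * The cardinality of Omega_M *)

Section CardOmegaM.
Variables (F : finFieldType) (n k l : nat) (al : 'I_k -> nat) (be : 'I_l -> nat).
Variables (M : {ffun 'I_k * 'I_l -> 'I_n.+1}).
Notation Q := #|F|.
Notation q := ((#|F|%:R : rat)^-1).
Hypotheses (sal : (\sum_i al i)%N = n) (sbe : (\sum_j be j)%N = n).
Hypothesis (HM : is_contingency al be M).

Let D i j := psum (fun a => psum (fun b => M (a, b) : nat) j) i.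
(** The dimension of [capW b]; by [rank_capW] the subtraction is exact. *)
Let W (b : 'I_k * 'I_l) := (D b.1.+1 b.2.+1 - M b)%N.

Lemma sum_contingency : (\sum_b (M b : nat))%N = n.
Proof.
transitivity (\sum_i al i)%N => //.
rewrite [RHS](eq_bigr _ (fun i _ => esym (row_sum HM i))) pair_big /=.
by apply: eq_bigr => -[].
Qed.

Lemma card_OmegaM_nat :
  (card_OmegaM F al be M * \prod_b \prod_(s < M b) (Q ^ (W b + M b) - Q ^ (W b + s)) =
   #|[set g : 'M[F]_n | g \in unitmx]| * \prod_(b : 'I_k * 'I_l) Q ^ (D b.1 b.2 * M b))%N.
Proof.
have [c Hc] : exists c : 'I_n -> 'I_k * 'I_l, forall b, #|[set r | c r == b]| = M b.
  by apply: block_assignment; apply: sum_contingency.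
pose S := [set y : 'M[F]_n * 'M[F]_n | (y.1 \in unitmx) && box_lower c y.1 (y.1 *m y.2)].
pose h (y : 'M[F]_n * 'M[F]_n) : tripleT F n k l := (flag1 c y.1, flag2 c y.1, y.2).
transitivity #|S|; [symmetry|].
  apply: (card_fibre (h := h)) => [[x N]|[[f g] N]]; rewrite !inE /in_Omega /=.
    case/andP=> xu; rewrite (box_lower_compat c xu) => /andP[-> ->].
    by rewrite (flag1_is_flag HM Hc xu) (flag2_is_flag HM Hc xu) (flags_relpos Hc xu).
  move=> /andP[/andP[/andP[/andP[ff fg] cf] cg] fgM].
  transitivity #|[set x | pair_adapted c f g x]|.
    rewrite -(card_imset (f := fun x => (x, N))); last by move=> x x' [].
    apply: eq_card => -[x N']; rewrite !inE /=; apply/idP/imsetP.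
      case/andP=> /andP[xu _] /eqP[<- <- ->]; exists x; rewrite ?inE //.
      exact: flags_adapted.
    case=> x'; rewrite inE => hx [-> ->].
    have [e1 e2] := pair_adapted_flags sal sbe Hc ff fg fgM hx.
    have xu := pair_adapted_unit sal HM Hc ff fg fgM hx.
    by rewrite /h /= e1 e2 eqxx andbT xu (box_lower_compat c xu) e1 e2 cf cg.
  rewrite card_block_free => [|b _]; last exact: (capWU ff fg).
  apply: eq_bigr => b _ /=; rewrite Hc (rank_capU fgM) -/(D _ _).
  have e := rank_capW ff fg fgM b; rewrite -/(D _ _) in e.
  by rewrite /W -e addnK.
apply: (card_fibre (h := fst)) => [[x N]|x]; rewrite !inE /=; first by case/andP.
move=> xu; transitivity #|[set Y | box_lower c x Y]|.
  have inj : injective (fun Y : 'M[F]_n => (x, invmx x *m Y)).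
    by move=> Y Y' /(congr1 (fun y => x *m y.2)) /=; rewrite !mulKVmx.
  rewrite -(card_imset _ inj); apply: eq_card => -[x' N]; rewrite !inE /=; apply/idP/imsetP.
    by case/andP=> /andP[_ hN] /eqP e; exists (x *m N); rewrite ?inE -?e // mulKmx // e.
  by case=> Y; rewrite inE => hY [-> ->]; rewrite xu mulKVmx // hY eqxx.
rewrite card_block_free //; apply: eq_bigr => b _ /=.
by rewrite rank_rowsel // (card_box Hc) Hc.
Qed.

(** From (i,j) to (i+1,j+1) the corner sum grows by an initial part of row i, an initial part of
    column j and M_ij. Weighted by M_ij, with m^2 = 2 C(m,2) + m, the row terms give C(alpha_i,2)
    and the column terms C(beta_j,2) by [psum_bin2]. This is where n(alpha) and n(beta) arise. *)
Lemma Omega_exponent : (\sum_(b : 'I_k * 'I_l) (W b + M b) * M b =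
  \sum_(b : 'I_k * 'I_l) D b.1 b.2 * M b + (nfun al + nfun be + n))%N.
Proof.
have e (b : 'I_k * 'I_l) : (W b + M b = D b.1 b.2 + psum (fun j => M (b.1, j) : nat) b.2
   + psum (fun i => M (i, b.2) : nat) b.1 + M b)%N.
  have h := corner_box M b.1 b.2; rewrite -surjective_pairing -!/(D _ _) in h.
  have h1 := corner_Sl M b.1 b.2; have h2 := corner_Sr M b.1 b.2; rewrite -!/(D _ _) in h1 h2.
  by rewrite /W; move: h h1 h2; move: (D _ _) (D _ _) (D _ _) (D _ _) (psum _ _) (psum _ _); lia.
under eq_bigr => b _ do rewrite e !mulnDl -!addnA.
rewrite big_split /=; congr addn.
have alE i : ('C(al i, 2) = \sum_j (M (i, j) * psum (fun j => M (i, j) : nat) j + 'C(M (i, j), 2)))%N.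
  rewrite -(row_sum HM) -psum_all -psum_bin2 //; apply: eq_bigl => j; exact: ltn_ord.
have beE j : ('C(be j, 2) = \sum_i (M (i, j) * psum (fun i => M (i, j) : nat) i + 'C(M (i, j), 2)))%N.
  rewrite -(col_sum HM) -psum_all -psum_bin2 //; apply: eq_bigl => i; exact: ltn_ord.
rewrite /nfun (eq_bigr _ (fun i _ => alE i)) [X in (_ + X + _)%N](eq_bigr _ (fun j _ => beE j)).
rewrite -[X in (_ + _ + X)%N]sum_contingency [X in (_ + X + _)%N]exchange_big /=.
rewrite !pair_big /= -!big_split /=; apply: eq_bigr => -[i j] _ /=.
have sq m : (m * m = 2 * 'C(m, 2) + m)%N.
  by elim: m => // m IH; rewrite binS bin1; lia.
by move: (psum _ _) (psum _ _) (sq (M (i, j))) => x y; nia.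
Qed.

Lemma card_OmegaME :
  (card_OmegaM F al be M)%:R * (Q%:R ^+ (nfun al + nfun be + n) * prodMfact q M) =
  Q%:R ^+ (n * n) * qfact q n.
Proof.
have Q1 := card_finNzRing_gt1 F.
have := congr1 (fun x : nat => x%:R : rat) card_OmegaM_nat.
rewrite !natrM natr_card_unitmx !natr_prod => main.
have K1 (b : 'I_k * 'I_l) : (\prod_(s < M b) (Q ^ (W b + M b) - Q ^ (W b + s)))%N%:R =
   Q%:R ^+ ((W b + M b) * M b) * (1 - q) ^+ M b * qfact q (M b).
  have := prod_natQ_sub Q1 (W b) (leqnn (M b)).
  by rewrite subnn {1}/qfact big_ord0 mulr1.
have K2 (b : 'I_k * 'I_l) : (Q ^ (D b.1 b.2 * M b))%N%:R = Q%:R ^+ (D b.1 b.2 * M b) :> rat.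
  by rewrite natrX.
rewrite (eq_bigr _ (fun b _ => K1 b)) [X in _ = _ * X](eq_bigr _ (fun b _ => K2 b)) in main.
move: main; rewrite !big_split /= -!expr_sum sum_contingency Omega_exponent exprD.
have -> : \prod_(i : 'I_k * 'I_l) qfact q (M i) = prodMfact q M.
  by rewrite /prodMfact pair_big /=; apply: eq_bigr => -[].
have A0 := natQX_neq0 Q1 (\sum_(b : 'I_k * 'I_l) D b.1 b.2 * M b)%N.
have B0 : (1 - q) ^+ n != 0 by rewrite expf_neq0 ?subq1_neq0.
have alg (o a x u p g z : rat) : a != 0 -> u != 0 ->
  o * (a * x * u * p) = g * u * z * a -> o * (x * p) = g * z.
  move=> a0 u0 h; apply: (mulIf (mulf_neq0 a0 u0)).
  transitivity (o * (a * x * u * p)); first by ring.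
  by rewrite h; ring.
exact: alg.
Qed.

End CardOmegaM.

(** * Jordan tableaux and relative positions *)

Section Tableau.
Variables (F : finFieldType) (n : nat).

(** A ∩ L and B ∩ K have their sum inside B ∩ L and their intersection inside A ∩ K. Both the strip
    inequalities and the non-negativity of the position matrix come from this. *)
Lemma rank_cap_submod m1 m2 m3 m4 (A : 'M[F]_(m1, n)) (B : 'M[F]_(m2, n))
    (K : 'M[F]_(m3, n)) (L : 'M[F]_(m4, n)) : (A <= B)%MS -> (K <= L)%MS ->
  (\rank (A :&: L)%MS + \rank (B :&: K)%MS <= \rank (B :&: L)%MS + \rank (A :&: K)%MS)%N.
Proof.
move=> AB KL; rewrite -mxrank_sum_cap; apply: leq_add; apply: mxrankS.
  by rewrite addsmx_sub !capmxS.
rewrite !sub_capmx (submx_trans (capmxSl _ _) (capmxSl _ _)).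
by rewrite (submx_trans (capmxSr _ _) (capmxSr _ _)).
Qed.

Variable N : 'M[F]_n.
Let d (V : 'M[F]_n) i : nat := \rank (V :&: kermx (N ^+ i))%MS.

Lemma kdim_leS V i : (d V i <= d V i.+1)%N.
Proof. by apply/mxrankS/capmxS => //; apply: ker_pow_sub. Qed.

Lemma kdim_le V i j : (i <= j)%N -> (d V i <= d V j)%N.
Proof. by move=> ij; apply/mxrankS/capmxS => //; apply: ker_pow_sub. Qed.

Lemma kdim_image V i : (d (V *m N) i + d V 1 = d V i.+1)%N.
Proof. exact: rank_image_ker_pow. Qed.

Lemma kdim_strip U V i : (V <= U)%MS -> (d V i.+1 - d V i <= d U i.+1 - d U i)%N.
Proof.
move=> VU; have := rank_cap_submod VU (ker_pow_sub N (leqnSn i)); rewrite -!/(d _ _).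
by move: (kdim_leS V i) (kdim_leS U i); lia.
Qed.

(** The parts of U N are those of U shifted by one, and U N lies in V. Consecutive flag steps
    thereby give horizontal strips; [V = U] gives nonincreasing parts. *)
Lemma kdim_strip_shift U V i : (U *m N <= V)%MS -> (d U i.+2 - d U i.+1 <= d V i.+1 - d V i)%N.
Proof.
move=> UV; have := rank_cap_submod UV (ker_pow_sub N (leqnSn i)); rewrite -!/(d _ _).
move: (kdim_image U i.+1) (kdim_image U i) (kdim_leS V i).
lia.
Qed.

Lemma sum_kdim V m : (\sum_(r < m) (d V r.+1 - d V r) = d V m)%N.
Proof.
elim: m => [|m IH]; first by rewrite big_ord0 /d ker_pow0 mxrank0.
by rewrite big_ord_recr /= IH subnKC // kdim_leS.
Qed.

(* The increments of dim ker N^i are nonincreasing, so once one vanishes the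
   dimension has reached n; hence n steps suffice. *)
Lemma nilpotent_pow_dim m : N ^+ m = 0 -> (1%:M <= kermx (N ^+ n))%MS.
Proof.
move=> Nm; pose I : 'M[F]_n := 1%:M; have dn i : (d I i <= n)%N by apply: rank_leq_col.
have dm : d I m = n.
  rewrite /d Nm; apply/eqP; have : (1%:M <= (1%:M : 'M_n) :&: kermx (0 : 'M[F]_n))%MS.
    by rewrite sub_capmx submx_refl sub_kermx mulmx0 eqxx.
  by rewrite sub1mx.
have stab i j : d I i.+1 = d I i -> d I (i + j)%N = d I i /\ d I (i + j).+1 = d I i.
  move=> e; elim: j => [|j [IH1 IH2]]; first by rewrite addn0.
  rewrite addnS; split=> //; have := @kdim_strip_shift I I (i + j)%N (submx1 _).
  by move: (kdim_leS I ((i + j).+1)%N); lia.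
have dich i : (i <= d I i)%N \/ d I i = n.
  elim: i => [|i [IH|IH]]; first by left.
    have [e|ne] := eqVneq (d I i.+1) (d I i).
      right; rewrite e; have [mi|im] := leqP m i.
        by move: (kdim_le I mi) (dn i); lia.
      by have [+ _] := stab i (m - i)%N e; rewrite subnKC ?dm // ltnW.
    by left; move: (kdim_leS I i); lia.
  by right; move: (kdim_leS I i) (dn i.+1); lia.
have h : d I n = n by case: (dich n) => // le; move: (dn n); lia.
rewrite sub1mx /row_full -[X in _ == X]h; apply/eqP/eqmx_rank.
by rewrite capmxSr sub_capmx submx1 submx_refl.
Qed.

Section Flag.
Variables (k : nat) (a : 'I_k -> nat) (f : flagT F n k).
Hypotheses (sa : (\sum_i a i)%N = n) (ff : is_flag a f) (cf : strict_compat f N).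

Let w (j : 'I_k) := widen_ord (leqnSn k) j.
Let s (j : 'I_k) : 'I_k.+1 := lift ord0 j.

Lemma flag_rank i : \rank (f i) = psum a i.
Proof. by have /andP[/forallP/(_ i)/andP[_ /eqP]] := ff. Qed.

Lemma flag_step j : (f (w j) <= f (s j))%MS.
Proof. by have /andP[_ /forallP/(_ j)] := ff. Qed.

Lemma flag_compat j : (f (s j) *m N <= f (w j))%MS.
Proof. by have /forallP/(_ j) := cf. Qed.

Lemma flag_zero : f ord0 = 0.
Proof. by apply/eqP; rewrite -mxrank_eq0 flag_rank psum0. Qed.

Lemma flag_stable i : (f i *m N <= f i)%MS.
Proof.
case: (unliftP ord0 i) => [j ->|->]; last by rewrite flag_zero mul0mx.
exact: submx_trans (flag_compat j) (flag_step j).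
Qed.

Lemma flag_full : (1%:M <= f ord_max)%MS.
Proof. by rewrite sub1mx /row_full flag_rank /= psum_all sa. Qed.

(** By induction F_i lies in ker N^i. As parts may be 0, [k] can exceed [n]; [nilpotent_pow_dim]
    then brings the exponent down to [n]. *)
Lemma flag_nilpotent : N ^+ k = 0.
Proof.
suff h i (ik : (i < k.+1)%N) : (f (Ordinal ik) <= kermx (N ^+ i))%MS.
  have eo : Ordinal (ltnSn k) = ord_max by apply: val_inj.
  have := h k (ltnSn k); rewrite eo => /(submx_trans flag_full).
  by rewrite sub_kermx mul1mx => /eqP.
elim: i ik => [|i IH] ik.
  have -> : Ordinal ik = ord0 by apply: val_inj.
  by rewrite flag_zero sub0mx.
rewrite sub_kermx -mulmx_exprS mulmxA -sub_kermx; apply: submx_trans (IH (ltnW ik)).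
have := flag_compat (Ordinal (ik : (i < k)%N)).
have -> : s (Ordinal (ik : (i < k)%N)) = Ordinal ik by apply: val_inj.
by have -> : w (Ordinal (ik : (i < k)%N)) = Ordinal (ltnW ik) by apply: val_inj.
Qed.

Definition jf_tab : tabT n k :=
  [ffun j => [ffun r : 'I_n => inord (d (f j) r.+1 - d (f j) r)]].

Lemma jf_tabE j r : (jf_tab j r : nat) = (d (f j) r.+1 - d (f j) r)%N.
Proof.
rewrite !ffunE inordK // ltnS; apply: leq_trans (leq_subr _ _) _; exact: rank_leq_col.
Qed.

Lemma jf_eq_tab T : jf_eq f N T = (T == jf_tab).
Proof.
apply/forallP/eqP => [h|-> j]; last by apply/forallP=> r; rewrite jf_tabE.
apply/ffunP=> j; apply/ffunP=> r; apply: val_inj; rewrite /= jf_tabE.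
by have /forallP/(_ r)/eqP := h j.
Qed.

Lemma pent_jf_tab j r : (r < n)%N -> pent (jf_tab j) r = (d (f j) r.+1 - d (f j) r)%N.
Proof. by move=> rn; rewrite (pent_ord (jf_tab j) (Ordinal rn)) jf_tabE. Qed.

Lemma sum_jf_tab j : (\sum_(r < n) (jf_tab j r : nat) = psum a j)%N.
Proof.
under eq_bigr => r _ do rewrite jf_tabE.
rewrite sum_kdim -flag_rank; apply: eqmx_rank; rewrite capmxSl sub_capmx submx_refl /=.
exact: submx_trans (submx1 _) (nilpotent_pow_dim flag_nilpotent).
Qed.

Lemma nonincr_jf_tab j : nonincr (jf_tab j).
Proof.
apply/forallP=> r; have [rn|nr] := ltnP r.+1 n; last by rewrite pent_out.
by rewrite !pent_jf_tab // ?(ltnW rn) //; apply/kdim_strip_shift/flag_stable.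
Qed.

Lemma jf_tab_ssyt lam : jf_tab ord_max = lam -> is_ssyt a lam jf_tab.
Proof.
move=> e; rewrite /is_ssyt e eqxx andbT -andbA; apply/and3P; split; apply/forallP.
- move=> r; rewrite jf_tabE flag_zero /d; apply/eqP.
  by rewrite (_ : _ :&: _ = 0)%MS ?mxrank0 //; apply/eqP; rewrite -submx0 capmxSl.
- by move=> j; rewrite nonincr_jf_tab sum_jf_tab eqxx.
move=> j; apply/forallP=> r; rewrite !(pent_jf_tab _ (ltn_ord r)) kdim_strip ?flag_step //=.
have [rn|nr] := ltnP r.+1 n; last by rewrite pent_out.
by rewrite pent_jf_tab //; apply/kdim_strip_shift/flag_compat.
Qed.

Lemma jf_tab_partition : is_partition (jf_tab ord_max).
Proof. by rewrite /is_partition nonincr_jf_tab sum_jf_tab /= psum_all sa eqxx. Qed.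

(** The last step is the whole space, so the shape depends on N alone: the tableaux of both flags
    have the same shape. *)
Lemma jf_tab_shape : jf_tab ord_max = [ffun r : 'I_n => inord (d 1%:M r.+1 - d 1%:M r)].
Proof.
rewrite ffunE; apply/ffunP=> r; rewrite !ffunE.
have e i : d (f ord_max) i = d 1%:M i.
  apply: eqmx_rank; rewrite !sub_capmx !capmxSr !submx1 /= andbT.
  exact: submx_trans (submx1 _) flag_full.
by rewrite !e.
Qed.

Lemma jf_shape_top lam T : is_ssyt a lam T -> jf_eq f N T -> jf_shape N 1%:M lam.
Proof.
move=> hT hf; have h : jf_shape N (f ord_max) lam.
  by have := hf; rewrite jf_eqE => /forallP/(_ ord_max); rewrite (ssyt_top hT).
apply/forallP=> i; rewrite -(eqP (forallP h i)); apply/eqP/eqmx_rank.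
rewrite !sub_capmx !capmxSr !submx1 /= !andbT.
exact: submx_trans (submx1 _) flag_full.
Qed.

End Flag.
End Tableau.

(** * The relative position of an arbitrary pair of flags *)

Section Position.
Variables (F : finFieldType) (n k l : nat) (al : 'I_k -> nat) (be : 'I_l -> nat).
Variables (f : flagT F n k) (g : flagT F n l).
Hypotheses (sal : (\sum_i al i)%N = n) (sbe : (\sum_j be j)%N = n).
Hypotheses (ff : is_flag al f) (fg : is_flag be g).

Let r i j : nat := \rank (f i :&: g j)%MS.
Let w (m : nat) (j : 'I_m) := widen_ord (leqnSn m) j.
Let s (m : nat) (j : 'I_m) : 'I_m.+1 := lift ord0 j.

(** The second difference of the ranks, which inverts corner sums. It is non-negative by
    submodularity and at most [n], so neither the truncated subtraction nor [inord] loses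
    anything. *)
Definition position : {ffun 'I_k * 'I_l -> 'I_n.+1} :=
  [ffun b => inord (r (s b.1) (s b.2) + r (w b.1) (w b.2) - r (w b.1) (s b.2) - r (s b.1) (w b.2))].

Lemma position_box i j :
  (r (s i) (s j) + r (w i) (w j) = r (w i) (s j) + r (s i) (w j) + position (i, j))%N.
Proof.
have h1 : (r (w i) (s j) + r (s i) (w j) <= r (s i) (s j) + r (w i) (w j))%N.
  exact: rank_cap_submod (flag_step ff i) (flag_step fg j).
have h2 : (r (w i) (w j) <= r (w i) (s j))%N by apply/mxrankS/capmxS => //; apply: flag_step fg j.
have h3 : (r (s i) (s j) <= n)%N by apply: rank_leq_col.
clear sal sbe; rewrite ffunE inordK /=; first by lia.
by rewrite ltnS; lia.
Qed.

Lemma position0l j : r ord0 j = 0%N.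
Proof.
apply/eqP; rewrite mxrank_eq0 -submx0 (submx_trans (capmxSl _ _)) // (flag_zero ff); exact: submx_refl.
Qed.

Lemma position0r i : r i ord0 = 0%N.
Proof.
apply/eqP; rewrite mxrank_eq0 -submx0 (submx_trans (capmxSr _ _)) // (flag_zero fg); exact: submx_refl.
Qed.

Lemma relpos_position : relpos f g position.
Proof.
apply/forallP=> i; apply/forallP=> j; apply/eqP; rewrite -/(r i j).
set D := fun p q => psum (fun a => psum (fun b => position (a, b) : nat) q) p.
change (r i j = D i j); case: i j => p Hp [q Hq]; rewrite [nat_of_ord _]/= [nat_of_ord (Ordinal Hq)]/=.
elim: p q Hp Hq => [|p IHp] q Hp Hq.
  rewrite (_ : Ordinal Hp = ord0) ?position0l; last exact: val_inj.
  by symmetry; apply: psum0.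
elim: q Hq => [|q IHq] Hq.
  rewrite (_ : Ordinal Hq = ord0) ?position0r; last exact: val_inj.
  by symmetry; apply: corner0r.
have := position_box (Ordinal (Hp : (p < k)%N)) (Ordinal (Hq : (q < l)%N)).
have := corner_box position (Ordinal (Hp : (p < k)%N)) (Ordinal (Hq : (q < l)%N)); rewrite -!/(D _ _) /=.
have -> : s (Ordinal (Hp : (p < k)%N)) = Ordinal Hp by apply: val_inj.
have -> : s (Ordinal (Hq : (q < l)%N)) = Ordinal Hq by apply: val_inj.
have -> : w (Ordinal (Hp : (p < k)%N)) = Ordinal (ltnW Hp) by apply: val_inj.
have -> : w (Ordinal (Hq : (q < l)%N)) = Ordinal (ltnW Hq) by apply: val_inj.
rewrite !(IHp _ (ltnW Hp)) IHq; set x := nat_of_ord (position _).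
by move: (D _ _) (D _ _) (D _ _) (D _ _) (r _ _) x; clear; lia.
Qed.

Lemma relposE M : relpos f g M = (M == position).
Proof.
apply/idP/eqP => [h|->]; last exact: relpos_position.
apply/ffunP=> -[i j]; apply: val_inj => /=.
have := position_box i j; have := corner_box M i j.
have e p q : r p q = psum (fun a => psum (fun b => M (a, b) : nat) q) p.
  by have /forallP/(_ p)/forallP/(_ q)/eqP := h.
rewrite !e /= !bump0; set x := nat_of_ord (M _); set y := nat_of_ord (position _).
by move: (psum _ _) (psum _ _) (psum _ _) (psum _ _) x y; clear; lia.
Qed.

Lemma position_contingency : is_contingency al be position.
Proof.
have e p q : r p q = psum (fun a => psum (fun b => position (a, b) : nat) q) p.
  by have /forallP/(_ p)/forallP/(_ q)/eqP := relpos_position.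
have rl p : r p ord_max = psum al p.
  rewrite -(flag_rank ff); apply: eqmx_rank; rewrite capmxSl sub_capmx submx_refl.
  exact: submx_trans (submx1 _) (flag_full sbe fg).
have rr q : r ord_max q = psum be q.
  rewrite -(flag_rank fg); apply: eqmx_rank; rewrite capmxSr sub_capmx submx_refl andbT.
  exact: submx_trans (submx1 _) (flag_full sal ff).
apply/andP; split; apply/forallP=> i; apply/eqP.
  have := rl (s i); have := rl (w i); rewrite !e /= !bump0 corner_Sl !psumS => -> /addnI <-.
  by rewrite psum_all.
have := rr (s i); have := rr (w i); rewrite !e /= !bump0 corner_Sr !psumS => -> /addnI <-.
by rewrite psum_all.
Qed.

End Position.

(** * The two evaluations *)

Section Assembly.
Variables (F : finFieldType) (n k l : nat) (al : 'I_k -> nat) (be : 'I_l -> nat).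
Notation Q := #|F|.
Notation q := ((#|F|%:R : rat)^-1).
Hypotheses (sal : (\sum_i al i)%N = n) (sbe : (\sum_j be j)%N = n).

(** For fixed N the two flags are chosen independently, and [card_flags] counts each of them in
    terms of the type of N only. *)
Lemma card_OmegaTT_types (lam : partT n) (T : tabT n k) (T' : tabT n l) :
  is_partition lam -> is_ssyt al lam T -> is_ssyt be lam T' ->
  (card_OmegaTT F al be T T')%:R * (Q%:R ^+ nfun al * Q%:R ^+ nfun be) =
  #|[set N : 'M[F]_n | jf_shape N 1%:M lam]|%:R *
   (Q%:R ^+ (\sum_(r < n) 'C(pent lam r, 2)) * wtq q T *
    (Q%:R ^+ (\sum_(r < n) 'C(pent lam r, 2)) * wtq q T')).
Proof.
move=> hl hT hT'; apply: (card_fibre_mulr (h := fun x : tripleT F n k l => x.2)).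
  move=> [[f g] N]; rewrite !inE /in_Omega /= => /andP[/andP[/andP[/andP[/andP[ff _] _] _] hf] _].
  exact: (jf_shape_top sal ff hT hf).
move=> N; rewrite inE => hN.
rewrite -(card_flags sal hT hN) -(card_flags sbe hT' hN) mulrACA -natrM -cardsX; congr (_%:R * _).
rewrite -(card_imset (f := fun y : flagT F n k * flagT F n l => (y, N))); last by move=> y y' [].
apply: eq_card => -[[f g] N']; rewrite !inE /in_Omega /=; apply/andP/imsetP.
  case=> h /eqP e; exists (f, g); last by rewrite e.
  by move: h; rewrite e !inE => /andP[/andP[/andP[/andP[/andP[-> ->] ->] ->] ->] ->].
case=> -[f' g']; rewrite !inE /= => h [-> -> ->]; split=> //.
by move: h => /andP[/andP[/andP[-> ->] ->] /andP[/andP[-> ->] ->]].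
Qed.

Lemma sum_sqr_bin2 (lam : partT n) : is_partition lam ->
  (\sum_(r < n) pent lam r * pent lam r =
   \sum_(r < n) 'C(pent lam r, 2) + \sum_(r < n) 'C(pent lam r, 2) + n)%N.
Proof.
move=> hl; have sl : (\sum_(r < n) pent lam r)%N = n by rewrite sum_pent sum_lam.
transitivity (\sum_(r < n) ('C(pent lam r, 2) + 'C(pent lam r, 2) + pent lam r))%N.
  apply: eq_bigr => r _; elim: (pent lam r) => // m IH.
  by rewrite binS bin1; move: IH; clear; lia.
by rewrite !big_split /= sl.
Qed.

(** The factors Q^(sum_r C(lam_r,2)) of the two flags cancel against Q^(sum_r lam_r^2) from the
    centralizer, leaving Q^n. *)
Lemma card_OmegaTTE (lam : partT n) (T : tabT n k) (T' : tabT n l) :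
  is_partition lam -> is_ssyt al lam T -> is_ssyt be lam T' ->
  (card_OmegaTT F al be T T')%:R *
    (Q%:R ^+ (nfun al + nfun be + n) * (1 - q) ^+ pent lam 0 * prodLfact q lam) =
  Q%:R ^+ (n * n) * (1 - q) ^+ n * qfact q n * wtq q T * wtq q T'.
Proof.
move=> hl hT hT'; have h1 := card_OmegaTT_types hl hT hT'.
have h2 := card_nilpotent F hl; rewrite (sum_sqr_bin2 hl) !exprD in h2.
have alg (o a N c w w' u t p x : rat) : o * a = N * (c * w * (c * w')) ->
  N * (c * c * u * t * p) = x -> o * (a * u * t * p) = x * w * w'.
  move=> e1 <-; transitivity (o * a * (u * t * p)); first by ring.
  by rewrite e1; ring.
by rewrite !exprD; apply: alg h1 h2.
Qed.

Lemma wtq_neq0 m (a : 'I_m -> nat) (T : tabT n m) : wtq q T != 0.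
Proof.
apply/prodf_neq0 => j _; apply/prodf_neq0 => r _.
by rewrite /qbinom mulf_neq0 ?invr_neq0 ?mulf_neq0 ?qfact_neq0.
Qed.

Lemma card_OmegaM_sum (M : {ffun 'I_k * 'I_l -> 'I_n.+1}) :
  card_OmegaM F al be M =
  (\sum_(lam : partT n | is_partition lam) \sum_(T : tabT n k | is_ssyt al lam T)
     \sum_(T' : tabT n l | is_ssyt be lam T') card_OmegaMTT F al be M T T')%N.
Proof.
pose tab1 (x : tripleT F n k l) := jf_tab x.2 x.1.1.
pose tab2 (x : tripleT F n k l) := jf_tab x.2 x.1.2.
rewrite /card_OmegaM -sum1_card.
rewrite (partition_big (fun x : tripleT F n k l => tab1 x ord_max) (@is_partition n)) /=; last first.
  move=> [[f g] N]; rewrite inE /in_Omega /= => /andP[/andP[/andP[/andP[ff _] cf] _] _].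
  exact: jf_tab_partition sal ff cf.
apply: eq_bigr => lam _.
rewrite (partition_big tab1 (is_ssyt al lam)) /=; last first.
  move=> [[f g] N]; rewrite inE /in_Omega /= => /andP[/andP[/andP[/andP[/andP[ff _] cf] _] _] /eqP e].
  exact: (jf_tab_ssyt sal ff cf e).
apply: eq_bigr => T hT.
rewrite (partition_big tab2 (is_ssyt be lam)) /=; last first.
  move=> [[f g] N]; rewrite inE /in_Omega /= => /andP[/andP[/andP[/andP[/andP[/andP[ff fg] cf] cg] _] /eqP e] _].
  apply: (jf_tab_ssyt sbe fg cg); rewrite -e /tab1 /=.
  by rewrite (jf_tab_shape N sal ff) (jf_tab_shape N sbe fg).
apply: eq_bigr => T' hT'; rewrite /card_OmegaMTT -sum1_card; apply: eq_bigl => -[[f g] N].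
rewrite !inE !jf_eq_tab /tab1 /tab2 /= (eq_sym T) (eq_sym T').
by case: (jf_tab N f =P T) => [->|_]; rewrite ?andbF // (ssyt_top hT) eqxx !andbT.
Qed.

Lemma card_OmegaTT_sum (T : tabT n k) (T' : tabT n l) :
  card_OmegaTT F al be T T' =
  (\sum_(M | is_contingency al be M) card_OmegaMTT F al be M T T')%N.
Proof.
rewrite /card_OmegaTT -sum1_card.
rewrite (partition_big (fun x : tripleT F n k l => position x.1.1 x.1.2) (is_contingency al be)) /=; last first.
  move=> [[f g] N]; rewrite inE /in_Omega /= => /andP[/andP[/andP[/andP[/andP[ff fg] _] _] _] _].
  exact: position_contingency.
apply: eq_bigr => M _; rewrite /card_OmegaMTT -sum1_card; apply: eq_bigl => -[[f g] N].
rewrite !inE /=; have [|] //= := boolP (in_Omega _ _ _).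
rewrite /in_Omega /= => /andP[/andP[/andP[ff fg] _] _].
by rewrite (relposE ff fg) (eq_sym M) [LHS]andbC andbA.
Qed.

Lemma exponentE : q ^ ((n ^ 2)%:Z - n%:Z - (nfun al)%:Z - (nfun be)%:Z) * Q%:R ^+ (n * n) =
  Q%:R ^+ (nfun al + nfun be + n).
Proof.
rewrite exprz_inv -mulnn ![Q%:R ^+ _]exprnP -expfzDr ?natQ_neq0 ?card_finNzRing_gt1 //.
by congr (_ ^ _); clear; lia.
Qed.
End Assembly.

Theorem theorem6p19 (F : finFieldType) (n k l : nat)
    (alpha : 'I_k -> nat) (beta : 'I_l -> nat)
    (Halpha : (\sum_(i < k) alpha i)%N = n) (Hbeta : (\sum_(j < l) beta j)%N = n) :
  let q : rat := (#|F|%:R)^-1 in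
  (forall (M : {ffun 'I_k * 'I_l -> 'I_n.+1}) (lam : partT n)
          (T : tabT n k) (T' : tabT n l),
     is_contingency alpha beta M -> is_partition lam ->
     is_ssyt alpha lam T -> is_ssyt beta lam T' ->
     (1 - q) ^- n / prodMfact q M * pM F alpha beta M T T'
       = q ^ ((n ^ 2)%:Z - n%:Z - (nfun alpha)%:Z - (nfun beta)%:Z) * (1 - q) ^- n
           / qfact q n * (card_OmegaMTT F alpha beta M T T')%:R
     /\
     q ^ ((n ^ 2)%:Z - n%:Z - (nfun alpha)%:Z - (nfun beta)%:Z) * (1 - q) ^- n
           / qfact q n * (card_OmegaMTT F alpha beta M T T')%:R
       = (1 - q) ^- (pent lam 0) / prodLfact q lam * wtq q T * wtq q T'
           * ptM F alpha beta M T T')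
  /\
  \sum_(M : {ffun 'I_k * 'I_l -> 'I_n.+1} | is_contingency alpha beta M)
      (1 - q) ^- n / prodMfact q M
  = \sum_(lam : partT n | is_partition lam)
      \sum_(T : tabT n k | is_ssyt alpha lam T)
        \sum_(T' : tabT n l | is_ssyt beta lam T')
          (1 - q) ^- (pent lam 0) / prodLfact q lam * wtq q T * wtq q T'.
Proof.
move=> q.
have Q1 := card_finNzRing_gt1 F.
have B0 m : (1 - q) ^+ m != 0 by rewrite expf_neq0 ?subq1_neq0.
have qf m : qfact q m != 0 by apply: qfact_neq0.
have PM0 (M : {ffun 'I_k * 'I_l -> 'I_n.+1}) : prodMfact q M != 0 by apply/prodf_neq0 => i _; apply/prodf_neq0 => j _; apply: qf.
have PL0 (lam : partT n) : prodLfact q lam != 0 by apply/prodf_neq0 => r _; apply: qf.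
(* Division by 0 gives 0 in [rat], so the probabilities sum to 1 only if the denominators are
   nonzero. This follows from the closed formulas, whose right sides are nonzero; no triple has to
   be exhibited. *)
have OM0 (M : {ffun 'I_k * 'I_l -> 'I_n.+1}) : is_contingency alpha beta M -> (card_OmegaM F alpha beta M)%:R != 0 :> rat.
  move=> hM; have := card_OmegaME F Halpha Hbeta hM; rewrite -/q.
  by apply: contra_eq_neq => ->; rewrite mul0r eq_sym mulf_neq0 ?natQX_neq0.
have OT0 (lam : partT n) (T : tabT n k) (T' : tabT n l) : is_partition lam -> is_ssyt alpha lam T -> is_ssyt beta lam T' ->
    (card_OmegaTT F alpha beta T T')%:R != 0 :> rat.
  move=> hl hT hT'; have := card_OmegaTTE F Halpha Hbeta hl hT hT'; rewrite -/q.
  by apply: contra_eq_neq => ->; rewrite mul0r eq_sym !mulf_neq0 ?natQX_neq0 ?wtq_neq0.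
have part1 (M : {ffun 'I_k * 'I_l -> 'I_n.+1}) (lam : partT n) (T : tabT n k) (T' : tabT n l) : is_contingency alpha beta M -> is_partition lam ->
     is_ssyt alpha lam T -> is_ssyt beta lam T' ->
     (1 - q) ^- n / prodMfact q M * pM F alpha beta M T T'
       = q ^ ((n ^ 2)%:Z - n%:Z - (nfun alpha)%:Z - (nfun beta)%:Z) * (1 - q) ^- n
           / qfact q n * (card_OmegaMTT F alpha beta M T T')%:R
     /\
     q ^ ((n ^ 2)%:Z - n%:Z - (nfun alpha)%:Z - (nfun beta)%:Z) * (1 - q) ^- n
           / qfact q n * (card_OmegaMTT F alpha beta M T T')%:R
       = (1 - q) ^- (pent lam 0) / prodLfact q lam * wtq q T * wtq q T'
           * ptM F alpha beta M T T'.
  move=> hM hl hT hT'.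
  have hA := card_OmegaME F Halpha Hbeta hM; have hB := card_OmegaTTE F Halpha Hbeta hl hT hT'.
  (* With Q^(n(alpha)+n(beta)+n) written as E Q^(n^2), where E is the power of q in the statement,
     Q^(n^2) cancels in both formulas. *)
  have hE := exponentE F n alpha beta; rewrite -hE -/q in hA hB.
  have E0 : q ^ ((n ^ 2)%:Z - n%:Z - (nfun alpha)%:Z - (nfun beta)%:Z) != 0.
    by rewrite expfz_neq0 // invr_neq0 // natQ_neq0.
  have R0 := natQX_neq0 Q1 (n * n).
  have OM := OM0 _ hM; have OT := OT0 _ _ _ hl hT hT'.
  have algA (b p x o e f r : rat) : b != 0 -> p != 0 -> o != 0 -> e != 0 -> r != 0 ->
    o * (e * r * p) = r * f -> b^-1 / p * (x / o) = e * b^-1 / f * x.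
    move=> b0 p0 o0 e0 r0 h; have <- : o * e * p = f by apply: (mulfI r0); rewrite -h; ring.
    by field; rewrite b0 p0 o0 e0.
  have algB (b c p x o e f r w w' : rat) : b != 0 -> c != 0 -> p != 0 -> o != 0 -> f != 0 -> r != 0 ->
    o * (e * r * c * p) = r * b * f * w * w' -> e * b^-1 / f * x = c^-1 / p * w * w' * (x / o).
    move=> b0 c0 p0 o0 f0 r0 h.
    have -> : c^-1 / p * w * w' * (x / o) = (r * b * f * w * w') * x / (c * p * o * r * b * f).
      by field; rewrite b0 c0 p0 o0 f0 r0.
    by rewrite -h; field; rewrite b0 c0 p0 o0 f0 r0.
  by split; [apply: algA hA | apply: algB hB].
split=> //.
(* The sum of [pM] over tableaux is inserted as a factor 1; after exchanging the sums, [part1] turns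
   it into [ptM], which sums to 1 over M. *)
transitivity (\sum_(M : {ffun 'I_k * 'I_l -> 'I_n.+1} | is_contingency alpha beta M) \sum_(lam : partT n | is_partition lam)
   \sum_(T : tabT n k | is_ssyt alpha lam T) \sum_(T' : tabT n l | is_ssyt beta lam T')
     (1 - q) ^- n / prodMfact q M * pM F alpha beta M T T').
  apply: eq_bigr => M hM; move: (_ / prodMfact q M) => x.
  transitivity (x * ((card_OmegaM F alpha beta M)%:R / (card_OmegaM F alpha beta M)%:R)).
    by rewrite divff ?mulr1 ?OM0.
  rewrite {1}(card_OmegaM_sum F Halpha Hbeta) natr_sum mulr_suml mulr_sumr; apply: eq_bigr => lam _.
  rewrite natr_sum mulr_suml mulr_sumr; apply: eq_bigr => T _.
  by rewrite natr_sum mulr_suml mulr_sumr.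
rewrite exchange_big /=; apply: eq_bigr => lam hl; rewrite exchange_big /=; apply: eq_bigr => T hT.
rewrite exchange_big /=; apply: eq_bigr => T' hT'.
transitivity (\sum_(M : {ffun 'I_k * 'I_l -> 'I_n.+1} | is_contingency alpha beta M) (1 - q) ^- (pent lam 0) / prodLfact q lam * wtq q T * wtq q T'
           * ptM F alpha beta M T T').
  by apply: eq_bigr => M hM; have [-> ->] := part1 M lam T T' hM hl hT hT'.
rewrite -mulr_sumr -mulr_suml -natr_sum -(card_OmegaTT_sum F Halpha Hbeta).
by rewrite divff ?mulr1 //; apply: OT0 hl hT hT'.
Qed.
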